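(* Let $p\ge1$ be an integer, let $f\in C^p(\mathbb{R}^n;\mathbb{R}^n)$ with $f(0)=0$, and let $V\in C^{p+1}(\mathbb{R}^n;\mathbb{R}^+)$ be a Lyapunov function for $\dot z=f(z)$. Consider the hybrid system (2.2) associated with a consistent Runge–Kutta scheme for $\dot z=f(z)$ and a continuous step bound $\varphi:\mathbb{R}^n\to(0,r]$, and suppose: (i) for each fixed $x$, the map $[0,\varphi(x)]\ni h\mapsto V(x+hF(h,x))$ is $(p+1)$ times continuously differentiable; (ii) the scheme is of order $p$: for every $x$ there is $K>0$ with $|z(h,x)-x-hF(h,x)|\le Kh^{p+1}$ for all $h\in[0,\varphi(x)]$; (iii) there is $\lambda\in(0,1)$ such that for every $x\in\mathbb{R}^n$, $$\varphi(x)\min_{j=1,\dots,p}K_j(x)\le(\lambda-1)L_fV(x),$$ where $K_1(x):=\tfrac12\max\{\tfrac{\partial^2}{\partial h^2}V(x+hF(h,x)):h\in[0,\varphi(x)]\}$ and, for $j\ge2$, $$K_j(x):=\max\Big\{\sum_{i=2}^j\frac{s^{i-2}}{i!}L_f^iV(x)+\frac{s^{j-1}}{(j+1)!}\frac{\partial^{j+1}}{\partial h^{j+1}}V(x+hF(h,x)) : h,s\in[0,\varphi(x)]\Big\}.$$ Then $0\in\mathbb{R}^n$ is URGAS for (2.2). If moreover there exist $\sigma,K>0$ with $\nabla V(x)f(x)\le-2\sigma V(x)$ and $V(x)\ge K|x|^2$ for all $x$, then $0$ is robustly K-exponentially stable for (2.2).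
   Context: Standing framework: $f$ locally Lipschitz with $f(0)=0$; $z(t,x)$ is the solution of $\dot z=f(z)$ (system (2.1)) with $z(0)=x$. A consistent $s$-stage Runge–Kutta scheme has coefficients $a_{ij},b_i$ with $\sum_ib_i=1$ and is represented by $F(h,x):=\sum_{i=1}^sb_if(Y_i)$ where $Y_i=x+h\sum_{j=1}^sa_{ij}f(Y_j)$, $i=1,\dots,s$; the continuous step bound $\varphi:\mathbb{R}^n\to(0,r]$ ($r>0$) is assumed small enough that these equations have a unique solution for all $h\in[0,\varphi(x)]$ and that $|F(h,x)|\le|x|M(|x|)$ for some continuous nondecreasing $M$. The hybrid system (2.2): for each locally bounded $u:\mathbb{R}^+\to\mathbb{R}^+$ and $x_0$, $\tau_0=0$, $x(0)=x_0$, $h_i=\varphi(x(\tau_i))\exp(-u(\tau_i))$, $\tau_{i+1}=\tau_i+h_i$, $x(t)=x(\tau_i)+(t-\tau_i)F(h_i,x(\tau_i))$ on $[\tau_i,\tau_{i+1}]$; its solution is denoted $x(t,x_0;u)$. URGAS: (a) for every $\varepsilon>0$ there is $\delta>0$ with $|x_0|<\delta\Rightarrow|x(t,x_0;u)|<\varepsilon$ for all $t\ge0$ and all $u$; (b) for every $R$, $\sup\{|x(t,x_0;u)|:t\ge0,|x_0|\le R,u\}<\infty$; (c) for all $\varepsilon,R$ there is $T$ with $|x(t,x_0;u)|\le\varepsilon$ for $t\ge T$, $|x_0|\le R$, all $u$ (all $u$ locally bounded, nonnegative). Robustly K-exponentially stable: there exist $a\in K_\infty$, $\sigma>0$ with $|x(t,x_0;u)|\le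 e^{-\sigma t}a(|x_0|)$ for all $t,x_0,u$. A Lyapunov function for $\dot z=f(z)$ is a positive definite, radially unbounded $C^1$ function $V$ with $\nabla V(x)f(x)<0$ for $x\ne0$. $L_fV:=\nabla V\,f$ and $L_f^{i+1}V:=L_f(L_f^iV)$. *)

(* Defs.v *)
From Stdlib Require Import Arith Factorial Reals Lra Lia Classical ClassicalEpsilon FunctionalExtensionality.
From Stdlib Require Fin.
Open Scope R_scope.

Definition vec (n : nat) := Fin.t n -> R.

Fixpoint sumFin (n : nat) : (Fin.t n -> R) -> R :=
  match n return (Fin.t n -> R) -> R with
  | O => fun _ => 0
  | S m => fun g => g Fin.F1 + sumFin m (fun i => g (Fin.FS i))
  end.

Definition vzero {n} : vec n := fun _ => 0.
Definition vadd {n} (x y : vec n) : vec n := fun k => x k + y k.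
Definition vsub {n} (x y : vec n) : vec n := fun k => x k - y k.
Definition vscal {n} (c : R) (x : vec n) : vec n := fun k => c * x k.
Definition vsum {n s} (g : Fin.t s -> vec n) : vec n := fun k => sumFin s (fun j => g j k).
Definition vnorm {n} (x : vec n) : R := sqrt (sumFin n (fun k => x k ^ 2)).
Definition ebasis {n} (i : Fin.t n) : vec n :=
  fun k => if Fin.eq_dec i k then 1 else 0.

Definition cont_at {n} (g : vec n -> R) (x : vec n) : Prop :=
  forall eps, 0 < eps -> exists d, 0 < d /\
    forall y, vnorm (vsub y x) < d -> Rabs (g y - g x) < eps.

(* the i-th partial derivative (its value when it exists) *)
Definition pderiv {n} (g : vec n -> R) (i : Fin.t n) (x : vec n) : R :=
  epsilon (inhabits 0)
    (fun l => derivable_pt_lim (fun t => g (vadd x (vscal t (ebasis i)))) 0 l).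

Fixpoint Ck {n} (k : nat) (g : vec n -> R) : Prop :=
  match k with
  | O => forall x, cont_at g x
  | S k' =>
      (forall i x, exists l,
          derivable_pt_lim (fun t => g (vadd x (vscal t (ebasis i)))) 0 l)
      /\ forall i, Ck k' (pderiv g i)
  end.

Definition CkV {n} (k : nat) (f : vec n -> vec n) : Prop :=
  forall i, Ck k (fun x => f x i).

Definition Lie {n} (f : vec n -> vec n) (W : vec n -> R) : vec n -> R :=
  fun x => sumFin n (fun k => pderiv W k x * f x k).
Definition LieIter {n} (f : vec n -> vec n) (i : nat) (W : vec n -> R) : vec n -> R :=
  Nat.iter i (Lie f) W.

Definition lyapunov {n} (f : vec n -> vec n) (V : vec n -> R) : Prop :=
  V vzero = 0 /\ (forall x, x <> vzero -> 0 < V x) /\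
  (forall B, exists Rad, forall x, Rad <= vnorm x -> B <= V x) /\
  Ck 1 V /\
  (forall x, x <> vzero -> Lie f V x < 0).

Definition cont_within (S : R -> Prop) (g : R -> R) (t : R) : Prop :=
  forall eps, 0 < eps -> exists d, 0 < d /\
    forall y, S y -> Rabs (y - t) < d -> Rabs (g y - g t) < eps.

Definition Dwithin (S : R -> Prop) (g : R -> R) (t l : R) : Prop :=
  forall eps, 0 < eps -> exists d, 0 < d /\
    forall h, h <> 0 -> Rabs h < d -> S (t + h) ->
      Rabs ((g (t + h) - g t) / h - l) < eps.

Definition deriv_within (S : R -> Prop) (g : R -> R) (t : R) : R :=
  epsilon (inhabits 0) (Dwithin S g t).

Definition nderiv_within (S : R -> Prop) (k : nat) (g : R -> R) : R -> R :=
  Nat.iter k (deriv_within S) g.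

Fixpoint Ck_within (S : R -> Prop) (k : nat) (g : R -> R) : Prop :=
  match k with
  | O => forall t, S t -> cont_within S g t
  | S k' => (forall t, S t -> exists l, Dwithin S g t l)
            /\ Ck_within S k' (deriv_within S g)
  end.

Definition Icc (a b : R) : R -> Prop := fun t => a <= t <= b.

Definition is_sol_on {n} (f : vec n -> vec n) (x : vec n) (T : R) (z : R -> vec n) : Prop :=
  z 0 = x /\
  forall t, 0 <= t <= T -> forall k, Dwithin (Icc 0 T) (fun s => z s k) t (f (z t) k).

Definition RK_stages {n s} (A : Fin.t s -> Fin.t s -> R) (f : vec n -> vec n)
    (h : R) (x : vec n) (Y : Fin.t s -> vec n) : Prop :=
  forall i, Y i = vadd x (vscal h (vsum (fun j => vscal (A i j) (f (Y j))))).

(* F(h,x) = sum_i b_i f(Y_i), Y the (unique, under the standing hypotheses)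
   solution of the stage equations *)
Definition RK_F {n s} (A : Fin.t s -> Fin.t s -> R) (b : Fin.t s -> R)
    (f : vec n -> vec n) (h : R) (x : vec n) : vec n :=
  let Y := epsilon (inhabits (fun (_ : Fin.t s) (_ : Fin.t n) => 0)) (RK_stages A f h x) in
  vsum (fun i => vscal (b i) (f (Y i))).

Fixpoint hyb_pts {n} (F : R -> vec n -> vec n) (phi : vec n -> R) (u : R -> R)
    (x0 : vec n) (k : nat) : R * vec n :=
  match k with
  | O => (0, x0)
  | S k' =>
      let (tau, xi) := hyb_pts F phi u x0 k' in
      let h := phi xi * exp (- u tau) in
      (tau + h, vadd xi (vscal h (F h xi)))
  end.

(* hyb F phi x0 u t y  :<->  x(t, x0; u) = y *)
Definition hyb {n} (F : R -> vec n -> vec n) (phi : vec n -> R)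
    (x0 : vec n) (u : R -> R) (t : R) (y : vec n) : Prop :=
  exists k, let (tau, xi) := hyb_pts F phi u x0 k in
    let h := phi xi * exp (- u tau) in
    tau <= t <= tau + h /\ y = vadd xi (vscal (t - tau) (F h xi)).

Definition admissible (u : R -> R) : Prop :=
  (forall t, 0 <= t -> 0 <= u t) /\
  (forall T, exists B, forall t, 0 <= t <= T -> u t <= B).

Definition URGAS {n} (H : vec n -> (R -> R) -> R -> vec n -> Prop) : Prop :=
  (forall x0 u, admissible u -> forall t, 0 <= t -> exists y, H x0 u t y) /\
  (forall eps, 0 < eps -> exists d, 0 < d /\
     forall x0 u t y, admissible u -> vnorm x0 < d -> 0 <= t -> H x0 u t y ->
       vnorm y < eps) /\
  (forall Rad, exists B, forall x0 u t y, admissible u -> vnorm x0 <= Rad -> 0 <= t ->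
       H x0 u t y -> vnorm y <= B) /\
  (forall eps Rad, 0 < eps -> exists T, forall x0 u t y, admissible u -> vnorm x0 <= Rad ->
       T <= t -> H x0 u t y -> vnorm y <= eps).

Definition K_infinity (a : R -> R) : Prop :=
  a 0 = 0 /\
  (forall t, 0 <= t -> cont_within (fun s => 0 <= s) a t) /\
  (forall t1 t2, 0 <= t1 < t2 -> a t1 < a t2) /\
  (forall B, exists t, 0 <= t /\ B <= a t).

Definition robust_K_exp_stable {n} (H : vec n -> (R -> R) -> R -> vec n -> Prop) : Prop :=
  exists a sigma, K_infinity a /\ 0 < sigma /\
    forall x0 u t y, admissible u -> 0 <= t -> H x0 u t y ->
      vnorm y <= exp (- sigma * t) * a (vnorm x0).

(* least upper bound (= max when attained) *)
Definition supR (P : R -> Prop) : R := epsilon (inhabits 0) (is_lub P).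

Definition Kconst {n} (f : vec n -> vec n) (V : vec n -> R)
    (F : R -> vec n -> vec n) (phi : vec n -> R) (j : nat) (x : vec n) : R :=
  let g := fun h => V (vadd x (vscal h (F h x))) in
  let I := Icc 0 (phi x) in
  match j with
  | O => 0 (* unused *)
  | S O => / 2 * supR (fun y => exists h, I h /\ y = nderiv_within I 2 g h)
  | _ => supR (fun y => exists h s, I h /\ I s /\
           y = sum_f 2 j (fun i => s ^ (i - 2) / INR (fact i) * LieIter f i V x)
               + s ^ (j - 1) / INR (fact (j + 1)) * nderiv_within I (j + 1) g h)
  end.

Fixpoint min1 (K : nat -> R) (p : nat) : R :=
  match p with
  | O | S O => K 1%nat
  | S q => Rmin (min1 K q) (K p)
  end.

(* Main.v *)
Require Import Defs.
From Stdlib Require Import Reals.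
From Stdlib Require Import Arith Factorial Lra Lia.
From Stdlib Require Import Classical ClassicalEpsilon FunctionalExtensionality.
From Stdlib Require Fin.
From Coquelicot Require Import Coquelicot.
Open Scope R_scope.

(* Put [g h = V (x + h F(h,x))].  The Lyapunov function confines the flow [z] of [f]
   to a compact sublevel set, so [z] exists on all of [[0, phi x]].  Since the scheme has
   order [p], [g h - V (z h) = O(h^(p+1))], and comparing Taylor coefficients gives
   [g^(i)(0) = L_f^i V x] for [i <= p].  Taylor's formula of order [j + 1] for [g] then
   yields [g h <= V x + h L_f V x + h^2 K_j x], and (iii) turns this into
   [V (x + h F(h,x)) <= V x + lambda h L_f V x] for every admissible step.  Along the
   grid points [V] therefore decreases at the rate [lambda L_f V]; between grid points the
   linear interpolation costs at most the factor [1 + r M(|x|)].  For the exponential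
   estimate [V] is dominated by the supremum of [V] over balls, which is locally
   Lipschitz in the radius. *)

(** * Euclidean norm and continuity in several variables *)

(** The order condition speaks about every solution on [[0, phi x]]; if no solution existed it would
    say nothing, which is why the flow has to be constructed on the whole interval.
    Differentiability in several variables is given by partial derivatives alone, so the chain rule
    and local Lipschitz bounds rest on a mean value formula that moves one coordinate at a time. In
    the step variable only derivatives relative to a closed interval exist; Taylor bounds are
    obtained by integrating inequalities through monotonicity, and the remainder is only ever
    bounded, never expressed. Uniformity in [u] comes from the form of the one-step estimate: the
    decrease is proportional to the step actually taken, so its sum over the grid depends on the
    elapsed time and not on how that time is subdivided. *)

Lemma functional_choice {A B} (P : A -> B -> Prop) :
  (forall a, exists b, P a b) -> exists g, forall a, P a (g a).
Proof.
  intros H. exists (fun a => proj1_sig (constructive_indefinite_description _ (H a))).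
  intros a. apply proj2_sig.
Qed.

Lemma sumFin_ext n (a b : Fin.t n -> R) :
  (forall i, a i = b i) -> sumFin n a = sumFin n b.
Proof. intros H; f_equal; apply functional_extensionality, H. Qed.

Lemma sumFin_le n (a b : Fin.t n -> R) :
  (forall i, a i <= b i) -> sumFin n a <= sumFin n b.
Proof.
  induction n as [|n IH]; intros H; simpl; [lra|].
  apply Rplus_le_compat; [apply H | apply IH; intros; apply H].
Qed.

Lemma sumFin_plus n (a b : Fin.t n -> R) :
  sumFin n (fun i => a i + b i) = sumFin n a + sumFin n b.
Proof. induction n as [|n IH]; simpl; [lra | rewrite IH; lra]. Qed.

Lemma sumFin_scal n c (a : Fin.t n -> R) :
  sumFin n (fun i => c * a i) = c * sumFin n a.
Proof. induction n as [|n IH]; simpl; [lra | rewrite IH; lra]. Qed.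

Lemma sumFin_const n c : sumFin n (fun _ => c) = INR n * c.
Proof.
  induction n as [|n IH]; [simpl; lra | rewrite S_INR; simpl; rewrite IH; lra].
Qed.

Lemma sumFin_abs n (a : Fin.t n -> R) :
  Rabs (sumFin n a) <= sumFin n (fun i => Rabs (a i)).
Proof.
  induction n as [|n IH]; simpl; [rewrite Rabs_R0; lra|].
  eapply Rle_trans; [apply Rabs_triang|].
  apply Rplus_le_compat_l, IH.
Qed.

Lemma sumFin_ge0 n (a : Fin.t n -> R) : (forall i, 0 <= a i) -> 0 <= sumFin n a.
Proof.
  intros H. pose proof (sumFin_le n _ _ H) as H'. rewrite sumFin_const in H'. lra.
Qed.

Lemma sumFin_ge_term n (a : Fin.t n -> R) :
  (forall i, 0 <= a i) -> forall i, a i <= sumFin n a.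
Proof.
  induction n as [|n IH]; intros H i; [inversion i|].
  simpl. pose proof (sumFin_ge0 n (fun i => a (Fin.FS i)) (fun i => H _)) as H'.
  pose proof (H Fin.F1) as H1.
  revert a H H' H1. apply (Fin.caseS' i).
  - intros; lra.
  - intros j a H H' H1. pose proof (IH (fun i => a (Fin.FS i)) (fun i => H _) j).
    simpl in *. lra.
Qed.

Lemma sumFin_cauchy_schwarz n (a b : Fin.t n -> R) :
  sumFin n (fun i => a i * b i) ^ 2
  <= sumFin n (fun i => a i ^ 2) * sumFin n (fun i => b i ^ 2).
Proof.
  induction n as [|n IH]; [simpl; lra|].
  cbn [sumFin].
  specialize (IH (fun i => a (Fin.FS i)) (fun i => b (Fin.FS i))).
  pose proof (sumFin_ge0 n (fun i => a (Fin.FS i) ^ 2) (fun i => pow2_ge_0 _)) as HX.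
  pose proof (sumFin_ge0 n (fun i => b (Fin.FS i) ^ 2) (fun i => pow2_ge_0 _)) as HY.
  cbv beta in *.
  set (S := sumFin n (fun i => a (Fin.FS i) * b (Fin.FS i))) in *.
  set (X := sumFin n (fun i => a (Fin.FS i) ^ 2)) in *.
  set (Y := sumFin n (fun i => b (Fin.FS i) ^ 2)) in *.
  set (u := a Fin.F1). set (v := b Fin.F1).
  (* After squaring, the cross term is controlled by [S ^ 2 <= X * Y] and by the square of
     [u ^ 2 * Y - v ^ 2 * X]. *)
  assert (H : 2 * (u * v * S) <= u ^ 2 * Y + v ^ 2 * X).
  { apply Rsqr_incr_0_var; unfold Rsqr.
    - assert (0 <= (u * v) ^ 2 * (X * Y - S ^ 2)).
      { apply Rmult_le_pos; [apply pow2_ge_0 | lra]. }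
      pose proof (pow2_ge_0 (u ^ 2 * Y - v ^ 2 * X)). nra.
    - pose proof (pow2_ge_0 u). pose proof (pow2_ge_0 v). nra. }
  nra.
Qed.

Lemma vnorm_ge0 n (x : vec n) : 0 <= vnorm x.
Proof. apply sqrt_pos. Qed.

Lemma vnorm_sqr n (x : vec n) : vnorm x ^ 2 = sumFin n (fun k => x k ^ 2).
Proof.
  unfold vnorm. rewrite <- Rsqr_pow2, Rsqr_sqrt; [easy|].
  apply sumFin_ge0; intros; apply pow2_ge_0.
Qed.

Lemma vnorm_le n (x : vec n) B :
  0 <= B -> sumFin n (fun k => x k ^ 2) <= B ^ 2 -> vnorm x <= B.
Proof.
  intros HB H. rewrite <- vnorm_sqr in H.
  apply Rsqr_incr_0_var; [rewrite !Rsqr_pow2; easy|easy].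
Qed.

Lemma vnorm_triangle n (x y : vec n) : vnorm (vadd x y) <= vnorm x + vnorm y.
Proof.
  pose proof (vnorm_ge0 n x) as Hx. pose proof (vnorm_ge0 n y) as Hy.
  apply vnorm_le; [lra|].
  rewrite (sumFin_ext n _ (fun k => (x k ^ 2 + y k ^ 2) + 2 * (x k * y k)))
    by (intros; unfold vadd; ring).
  rewrite !sumFin_plus, sumFin_scal, <- !vnorm_sqr.
  pose proof (sumFin_cauchy_schwarz n x y) as H. rewrite <- !vnorm_sqr in H.
  assert (sumFin n (fun i => x i * y i) <= vnorm x * vnorm y).
  { apply Rsqr_incr_0_var; unfold Rsqr; nra. }
  nra.
Qed.

Lemma vnorm_scal n c (x : vec n) : vnorm (vscal c x) = Rabs c * vnorm x.
Proof.
  unfold vnorm, vscal.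
  rewrite (sumFin_ext n _ (fun k => c ^ 2 * x k ^ 2)) by (intros; ring).
  rewrite sumFin_scal, sqrt_mult, <- Rsqr_pow2, sqrt_Rsqr_abs; auto using pow2_ge_0.
  apply sumFin_ge0; intros; apply pow2_ge_0.
Qed.

Lemma vnorm_zero n : @vnorm n vzero = 0.
Proof.
  apply Rle_antisym; [|apply vnorm_ge0]. apply vnorm_le; [lra|].
  unfold vzero. rewrite (sumFin_ext n _ (fun _ => 0)) by (intros; ring).
  rewrite sumFin_const. lra.
Qed.

Lemma vnorm_ge_coord n (x : vec n) k : Rabs (x k) <= vnorm x.
Proof.
  apply Rsqr_incr_0_var; [|apply vnorm_ge0].
  rewrite !Rsqr_pow2, vnorm_sqr, pow2_abs.
  apply (sumFin_ge_term n (fun k => x k ^ 2)). intros; apply pow2_ge_0.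
Qed.

Lemma vnorm_le_coord n (x : vec n) d :
  0 <= d -> (forall k, Rabs (x k) <= d) -> vnorm x <= (INR n + 1) * d.
Proof.
  intros Hd H. pose proof (pos_INR n). apply vnorm_le; [nra|].
  apply Rle_trans with (INR n * d ^ 2).
  - rewrite <- sumFin_const. apply sumFin_le. intros i. rewrite <- pow2_abs.
    apply pow_incr. split; [apply Rabs_pos | apply H].
  - assert (0 <= d ^ 2) by apply pow2_ge_0. nra.
Qed.

(** Boxes are what the compactness argument and the coordinatewise mean value formula produce, so
    continuity is mostly used in this sup-norm form. *)
Lemma cont_at_coord n (g : vec n -> R) x :
  cont_at g x <->
  forall eps, 0 < eps -> exists d, 0 < d /\
    forall y, (forall k, Rabs (y k - x k) < d) -> Rabs (g y - g x) < eps.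
Proof.
  split; intros H eps He; destruct (H eps He) as (d & Hd & Hg).
  - pose proof (pos_INR n).
    exists (d / (INR n + 2)). split; [apply Rdiv_lt_0_compat; lra|].
    intros y Hy. apply Hg.
    apply Rle_lt_trans with ((INR n + 1) * (d / (INR n + 2))).
    + apply vnorm_le_coord; [apply Rlt_le, Rdiv_lt_0_compat; lra|].
      intros k. apply Rlt_le, Hy.
    + apply Rmult_lt_reg_r with (INR n + 2); [lra|]. field_simplify; [|lra]. nra.
  - exists d. split; [easy|]. intros y Hy. apply Hg. intros k.
    eapply Rle_lt_trans; [|exact Hy]. apply (vnorm_ge_coord n (vsub y x) k).
Qed.

Lemma cont_at_comp n (g : vec n -> R) (q : R -> R) x :
  cont_at g x -> continuity_pt q (g x) -> cont_at (fun y => q (g y)) x.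
Proof.
  intros Hg Hq eps He.
  destruct (proj1 (continuity_pt_locally q (g x)) Hq (mkposreal eps He)) as [d Hd].
  destruct (Hg d (cond_pos d)) as (e & He' & H).
  exists e. split; [easy|]. intros y Hy. apply (Hd (g y)), H, Hy.
Qed.

Lemma cont_at_const n c (x : vec n) : cont_at (fun _ => c) x.
Proof.
  intros eps He. exists 1. split; [lra|]. intros. rewrite Rminus_eq_0, Rabs_R0; easy.
Qed.

Lemma cont_at_plus n (g h : vec n -> R) x :
  cont_at g x -> cont_at h x -> cont_at (fun y => g y + h y) x.
Proof.
  intros Hg Hh eps He.
  destruct (Hg (eps / 2) ltac:(lra)) as (d & Hd & H1).
  destruct (Hh (eps / 2) ltac:(lra)) as (e & He' & H2).
  exists (Rmin d e). split; [apply Rmin_pos; easy|].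
  intros y Hy. pose proof (Rmin_l d e). pose proof (Rmin_r d e).
  replace (g y + h y - (g x + h x)) with ((g y - g x) + (h y - h x)) by ring.
  eapply Rle_lt_trans; [apply Rabs_triang|].
  specialize (H1 y ltac:(lra)). specialize (H2 y ltac:(lra)). lra.
Qed.

Lemma cont_at_scal n c (g : vec n -> R) x :
  cont_at g x -> cont_at (fun y => c * g y) x.
Proof.
  intros H. apply (cont_at_comp n g (fun t => c * t)); [easy|]. reg.
Qed.

Lemma cont_at_mult n (g h : vec n -> R) x :
  cont_at g x -> cont_at h x -> cont_at (fun y => g y * h y) x.
Proof.
  intros Hg Hh.
  (* Polarization: squares are compositions with a function of one variable, so only sums and
     compositions are needed. *)
  replace (fun y => g y * h y)
    with (fun y => / 4 * Rsqr (g y + h y) + - / 4 * Rsqr (g y + - 1 * h y))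
    by (apply functional_extensionality; intros; unfold Rsqr; field).
  assert (Hs : forall t, continuity_pt Rsqr t) by (intros; apply derivable_continuous_pt, derivable_pt_Rsqr).
  apply cont_at_plus; apply cont_at_scal;
    apply (cont_at_comp _ (fun y => _ + _) Rsqr); auto using cont_at_plus, cont_at_scal.
Qed.

Lemma cont_at_vnorm n (x : vec n) : cont_at vnorm x.
Proof.
  intros eps He. exists eps. split; [easy|]. intros y Hy.
  eapply Rle_lt_trans; [|exact Hy].
  assert (H1 : vnorm y <= vnorm (vsub y x) + vnorm x).
  { eapply Rle_trans; [|apply vnorm_triangle]. right. f_equal.
    apply functional_extensionality; intros; unfold vadd, vsub; ring. }
  assert (H2 : vnorm x <= vnorm (vsub y x) + vnorm y).
  { replace (vnorm (vsub y x)) with (vnorm (vscal (-1) (vsub y x)))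
      by (rewrite vnorm_scal, Rabs_left; lra).
    eapply Rle_trans; [|apply vnorm_triangle]. right. f_equal.
    apply functional_extensionality; intros; unfold vadd, vsub, vscal; ring. }
  apply Rabs_le. lra.
Qed.

(** * Compactness of boxes and the coordinatewise mean value formula *)

Fixpoint tuple_of_vec (n : nat) : vec n -> Tn n R :=
  match n with
  | O => fun _ => tt
  | S m => fun x => (x Fin.F1, tuple_of_vec m (fun i => x (Fin.FS i)))
  end.

Definition vcons {n} (a : R) (x : vec n) : vec (S n) :=
  fun k => Fin.caseS' k (fun _ => R) a x.

Lemma vcons_eta n (x : vec (S n)) : x = vcons (x Fin.F1) (fun i => x (Fin.FS i)).
Proof. apply functional_extensionality; intros k. apply (Fin.caseS' k); easy. Qed.

Fixpoint vec_of_tuple (n : nat) : Tn n R -> vec n :=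
  match n with
  | O => fun _ => vzero
  | S m => fun x => vcons (fst x) (vec_of_tuple m (snd x))
  end.

(** A Lebesgue-number form of compactness, transported from nested tuples. The source states it
    under a double negation, removed here classically. *)
Lemma vec_compactness n Rad (delta : vec n -> posreal) :
  exists d, 0 < d /\ forall x, (forall k, Rabs (x k) <= Rad) ->
    exists t, (forall k, Rabs (x k - t k) < delta t) /\ d <= delta t.
Proof.
  destruct (compactness_value n (tuple_of_vec n (fun _ => - Rad))
    (tuple_of_vec n (fun _ => Rad)) (fun t => delta (vec_of_tuple n t))) as [d Hd].
  exists d. split; [apply cond_pos|]. intros x Hx.
  assert (Hb : bounded_n n (tuple_of_vec n (fun _ => - Rad))
                 (tuple_of_vec n (fun _ => Rad)) (tuple_of_vec n x)).
  { clear - Hx. induction n as [|n IH]; simpl; [easy|].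
    pose proof (Hx Fin.F1) as H. apply Rabs_le_between in H.
    split; [lra|]. apply IH. intros; apply Hx. }
  specialize (Hd _ Hb). apply NNPP in Hd. destruct Hd as (t & _ & Hc & Hdt).
  exists (vec_of_tuple n t). split; [|easy].
  revert Hc. generalize (delta (vec_of_tuple n t) : R). intros e. clear.
  induction n as [|n IH]; intros H k; [inversion k|].
  destruct t as [a t]. destruct H as [H1 H2].
  revert x H1 H2. apply (Fin.caseS' k); intros; simpl in *; [easy|].
  apply (IH (fun i => x (Fin.FS i)) t H2).
Qed.

Lemma positive_lower_bound n (g : vec n -> R) Rad :
  (forall x, cont_at g x) -> (forall x, 0 < g x) ->
  exists c, 0 < c /\ forall x, (forall k, Rabs (x k) <= Rad) -> c <= g x.
Proof.
  intros Hc Hpos.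
  assert (Hd : forall t, exists d : posreal, forall x, (forall k, Rabs (x k - t k) < d) -> d <= g x).
  { intros t. destruct (proj1 (cont_at_coord n g t) (Hc t) (g t / 2)) as (d & Hd & H).
    { specialize (Hpos t); lra. }
    (* The radius is made to serve also as a lower bound for [g] near [t]; the uniform radius given
       by compactness is then itself the constant sought. *)
    assert (Hm : 0 < Rmin d (g t / 2)) by (apply Rmin_pos; [|specialize (Hpos t)]; lra).
    exists (mkposreal _ Hm). simpl. intros x Hx.
    pose proof (Rmin_l d (g t / 2)). pose proof (Rmin_r d (g t / 2)).
    assert (H' : Rabs (g x - g t) < g t / 2) by (apply H; intros k; specialize (Hx k); lra).
    apply Rabs_def2 in H'. lra. }
  destruct (functional_choice _ Hd) as [delta Hdelta].
  destruct (vec_compactness n Rad delta) as (d & Hd0 & H).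
  exists d. split; [easy|]. intros x Hx. destruct (H x Hx) as (t & Ht & Hdt).
  specialize (Hdelta t x Ht). lra.
Qed.

(** A positive lower bound for the continuous function [1 / (1 + |g|)] is an upper bound for
    [|g|]. *)
Lemma bounded_on_box n (g : vec n -> R) Rad :
  (forall x, cont_at g x) ->
  exists C, 0 < C /\ forall x, (forall k, Rabs (x k) <= Rad) -> Rabs (g x) <= C.
Proof.
  intros Hc.
  destruct (positive_lower_bound n (fun x => / (1 + Rabs (g x))) Rad) as (c & Hc0 & H).
  - intros x. apply (cont_at_comp n g (fun t => / (1 + Rabs t))); [easy|].
    apply continuity_pt_inv; [|pose proof (Rabs_pos (g x)); lra].
    apply continuity_pt_plus; [apply continuity_pt_const; intros ? ?; easy|].
    apply Rcontinuity_abs.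
  - intros x. apply Rinv_0_lt_compat. pose proof (Rabs_pos (g x)); lra.
  - exists (/ c). split; [apply Rinv_0_lt_compat; easy|]. intros x Hx.
    specialize (H x Hx). apply Rinv_le_contravar in H; [|easy].
    rewrite Rinv_inv in H. lra.
Qed.

Lemma vadd_scal0 n (x v : vec n) : vadd x (vscal 0 v) = x.
Proof. apply functional_extensionality; intros; unfold vadd, vscal; ring. Qed.

Lemma ebasis_FS n (i k : Fin.t n) : ebasis (Fin.FS i) (Fin.FS k) = ebasis i k.
Proof.
  unfold ebasis. destruct (Fin.eq_dec i k) as [->|H].
  - destruct (Fin.eq_dec (Fin.FS k) (Fin.FS k)); easy.
  - destruct (Fin.eq_dec (Fin.FS i) (Fin.FS k)) as [H'|]; [|easy].
    apply Fin.FS_inj in H'; easy.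
Qed.

Lemma vadd_ebasis_F1 n s t (x : vec n) :
  vadd (vcons s x) (vscal t (ebasis Fin.F1)) = vcons (s + t) x.
Proof.
  apply functional_extensionality; intros k. apply (Fin.caseS' k);
    unfold vadd, vscal; simpl; [|intros i]; unfold ebasis.
  - destruct (Fin.eq_dec Fin.F1 Fin.F1); [ring|easy].
  - destruct (Fin.eq_dec Fin.F1 (Fin.FS i)); [easy|ring].
Qed.

Lemma vadd_ebasis_FS n a t (x : vec n) i :
  vadd (vcons a x) (vscal t (ebasis (Fin.FS i))) = vcons a (vadd x (vscal t (ebasis i))).
Proof.
  apply functional_extensionality; intros k. apply (Fin.caseS' k);
    unfold vadd, vscal; simpl; [|intros j].
  - unfold ebasis. destruct (Fin.eq_dec (Fin.FS i) Fin.F1); [easy|ring].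
  - rewrite ebasis_FS. ring.
Qed.

(* Changing one coordinate at a time only uses partial derivatives; the
   intermediate points stay in the box spanned by [x] and [y]. *)
Lemma mean_value_coord n (W : vec n -> R) (w : Fin.t n -> vec n -> R) :
  (forall i x, derivable_pt_lim (fun t => W (vadd x (vscal t (ebasis i)))) 0 (w i x)) ->
  forall x y, exists xi : Fin.t n -> vec n,
    (forall i k, Rmin (x k) (y k) <= xi i k <= Rmax (x k) (y k)) /\
    W y - W x = sumFin n (fun i => w i (xi i) * (y i - x i)).
Proof.
  induction n as [|n IH]; intros Hw x y.
  { exists (fun _ => x). split; [intros i; inversion i|].
    replace y with x; [simpl; ring|].
    apply functional_extensionality; intros k; inversion k. }
  rewrite (vcons_eta n x), (vcons_eta n y).
  set (a := x Fin.F1). set (b := y Fin.F1).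
  set (x' := fun i => x (Fin.FS i)). set (y' := fun i => y (Fin.FS i)).
  destruct (IH (fun z => W (vcons a z)) (fun i z => w (Fin.FS i) (vcons a z))) with (x := x') (y := y')
    as (xi & Hxi & Heq).
  { intros i z. eapply derivable_pt_lim_ext; [|apply (Hw (Fin.FS i) (vcons a z))].
    intros t. simpl. now rewrite vadd_ebasis_FS. }
  (* The first coordinate moves last: the induction hypothesis leads from [(a, x')] to [(a, y')],
     and this segment from there to [(b, y')]. *)
  destruct (MVT_gen (fun s => W (vcons s y')) a b (fun s => w Fin.F1 (vcons s y')))
    as (c & Hc & Hceq).
  { intros s _. apply is_derive_Reals.
    intros eps He. destruct (Hw Fin.F1 (vcons s y') eps He) as [d Hd].
    exists d. intros h Hh Hhd. specialize (Hd h Hh Hhd).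
    rewrite !vadd_ebasis_F1, Rplus_0_l, Rplus_0_r in Hd. exact Hd. }
  { intros s _. apply derivable_continuous_pt.
    exists (w Fin.F1 (vcons s y')).
    intros eps He. destruct (Hw Fin.F1 (vcons s y') eps He) as [d Hd].
    exists d. intros h Hh Hhd. specialize (Hd h Hh Hhd).
    rewrite !vadd_ebasis_F1, Rplus_0_l, Rplus_0_r in Hd. exact Hd. }
  exists (fun i => Fin.caseS' i (fun _ => vec (S n)) (vcons c y') (fun j => vcons a (xi j))).
  split.
  - intros i k. apply (Fin.caseS' i); [|intros j]; apply (Fin.caseS' k); simpl.
    + exact Hc.
    + intros l. split; [apply Rmin_r|apply Rmax_r].
    + split; [apply Rmin_l|apply Rmax_l].
    + intros l. apply Hxi.
  - simpl. cbv beta in *. rewrite <- Heq, <- Hceq. ring.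
Qed.

(** * Partial derivatives and the chain rule *)

Lemma pderiv_spec n (g : vec n -> R) i x :
  (exists l, derivable_pt_lim (fun t => g (vadd x (vscal t (ebasis i)))) 0 l) ->
  derivable_pt_lim (fun t => g (vadd x (vscal t (ebasis i)))) 0 (pderiv g i x).
Proof. intros H. unfold pderiv. apply epsilon_spec, H. Qed.

Lemma pderiv_eq n (g : vec n -> R) i x l :
  derivable_pt_lim (fun t => g (vadd x (vscal t (ebasis i)))) 0 l -> pderiv g i x = l.
Proof.
  intros H. eapply uniqueness_limite; [|exact H]. apply pderiv_spec. now exists l.
Qed.

Lemma Ck1_mean_value n (W : vec n -> R) : Ck 1 W ->
  forall x y, exists xi : Fin.t n -> vec n,
    (forall i k, Rmin (x k) (y k) <= xi i k <= Rmax (x k) (y k)) /\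
    W y - W x = sumFin n (fun i => pderiv W i (xi i) * (y i - x i)).
Proof.
  intros [H _]. apply mean_value_coord. intros i x. apply pderiv_spec, H.
Qed.

Lemma bounded_on_box_family n m (g : Fin.t m -> vec n -> R) Rad :
  (forall i x, cont_at (g i) x) ->
  exists C, 0 < C /\ forall i x, (forall k, Rabs (x k) <= Rad) -> Rabs (g i x) <= C.
Proof.
  induction m as [|m IH]; intros H.
  { exists 1. split; [lra|]. intros i; inversion i. }
  destruct (IH (fun i => g (Fin.FS i)) (fun i => H _)) as (C1 & HC1 & H1).
  destruct (bounded_on_box n (g Fin.F1) Rad (H _)) as (C2 & HC2 & H2).
  exists (C1 + C2). split; [lra|]. intros i x Hx. apply (Fin.caseS' i).
  - specialize (H2 x Hx). lra.
  - intros j. specialize (H1 j x Hx). simpl in H1. lra.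
Qed.

Lemma Ck1_lipschitz_on_box n (W : vec n -> R) Rad : Ck 1 W ->
  exists C, 0 < C /\ forall x y,
    (forall k, Rabs (x k) <= Rad) -> (forall k, Rabs (y k) <= Rad) ->
    Rabs (W y - W x) <= C * sumFin n (fun k => Rabs (y k - x k)).
Proof.
  intros HW.
  destruct (bounded_on_box_family n n (pderiv W) Rad) as (C & HC & H).
  { intros i. apply HW. }
  exists C. split; [easy|]. intros x y Hx Hy.
  destruct (Ck1_mean_value n W HW x y) as (xi & Hxi & ->).
  eapply Rle_trans; [apply sumFin_abs|]. rewrite <- sumFin_scal.
  apply sumFin_le. intros i. rewrite Rabs_mult.
  apply Rmult_le_compat_r; [apply Rabs_pos|]. apply H. intros k.
  specialize (Hxi i k). specialize (Hx k). specialize (Hy k).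
  apply Rabs_le_between in Hx. apply Rabs_le_between in Hy. apply Rabs_le_between.
  revert Hxi. unfold Rmin, Rmax. destruct (Rle_dec (x k) (y k)); lra.
Qed.

Lemma Ck1_cont n (W : vec n -> R) : Ck 1 W -> forall x, cont_at W x.
Proof.
  intros HW x. apply cont_at_coord. intros eps He.
  destruct (Ck1_lipschitz_on_box n W (vnorm x + 1) HW) as (C & HC & H).
  pose proof (pos_INR n).
  assert (HCn : 0 < C * (INR n + 1)) by nra.
  assert (Hd : 0 < eps / (C * (INR n + 1))) by (apply Rdiv_lt_0_compat; easy).
  exists (Rmin 1 (eps / (C * (INR n + 1)))). split; [apply Rmin_pos; lra|].
  intros y Hy.
  pose proof (Rmin_l 1 (eps / (C * (INR n + 1)))).
  pose proof (Rmin_r 1 (eps / (C * (INR n + 1)))).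
  eapply Rle_lt_trans; [apply H|].
  - intros k. pose proof (vnorm_ge_coord n x k). lra.
  - intros k. pose proof (vnorm_ge_coord n x k). specialize (Hy k).
    replace (y k) with ((y k - x k) + x k) by ring.
    eapply Rle_trans; [apply Rabs_triang|]. lra.
  - apply Rle_lt_trans with (C * (INR n * (eps / (C * (INR n + 1))))).
    + apply Rmult_le_compat_l; [lra|]. rewrite <- sumFin_const. apply sumFin_le.
      intros k. specialize (Hy k). lra.
    + apply Rmult_lt_reg_r with (INR n + 1); [lra|]. field_simplify; [|lra]. nra.
Qed.

(** All the content is in the base case, where continuous partial derivatives force continuity. *)
Lemma Ck_S n k : forall g : vec n -> R, Ck (S k) g -> Ck k g.
Proof.
  induction k as [|k IH]; intros g H.
  - exact (Ck1_cont n g H).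
  - destruct H as [H1 H2]. split; [exact H1|]. intros i. apply IH, H2.
Qed.

Lemma Ck_le n k l (g : vec n -> R) : (k <= l)%nat -> Ck l g -> Ck k g.
Proof. induction 1; auto using Ck_S. Qed.

Lemma Ck_cont n k (g : vec n -> R) : Ck k g -> forall x, cont_at g x.
Proof. intros H. apply (Ck_le n 0 k g); [lia|easy]. Qed.

Lemma Ck_const n k c : Ck k (fun _ : vec n => c).
Proof.
  revert c. induction k as [|k IH]; intros c.
  - intros x. apply cont_at_const.
  - assert (H : forall i x, derivable_pt_lim
        (fun t => (fun _ : vec n => c) (vadd x (vscal t (ebasis i)))) 0 0)
      by (intros; apply derivable_pt_lim_const).
    split; [intros i x; exists 0; exact (H i x)|]. intros i.
    replace (pderiv (fun _ => c) i) with (fun _ : vec n => 0); [apply IH|].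
    apply functional_extensionality; intros x. symmetry. exact (pderiv_eq _ _ _ _ _ (H i x)).
Qed.

Lemma Ck_plus n k : forall g h : vec n -> R,
  Ck k g -> Ck k h -> Ck k (fun x => g x + h x).
Proof.
  induction k as [|k IH]; intros g h Hg Hh.
  - intros x. apply cont_at_plus; auto.
  - destruct Hg as [Hg1 Hg2], Hh as [Hh1 Hh2].
    assert (H : forall i x, derivable_pt_lim
        (fun t => (fun x => g x + h x) (vadd x (vscal t (ebasis i)))) 0
        (pderiv g i x + pderiv h i x)).
    { intros i x. apply (derivable_pt_lim_plus (fun t => g _) (fun t => h _));
        apply pderiv_spec; auto. }
    split; [intros i x; eexists; apply H|]. intros i.
    replace (pderiv (fun x => g x + h x) i) with (fun x => pderiv g i x + pderiv h i x).
    { apply IH; auto. }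
    apply functional_extensionality; intros x. symmetry. apply pderiv_eq, H.
Qed.

Lemma Ck_mult n k : forall g h : vec n -> R,
  Ck k g -> Ck k h -> Ck k (fun x => g x * h x).
Proof.
  induction k as [|k IH]; intros g h Hg Hh.
  - intros x. apply cont_at_mult; auto.
  - pose proof (Ck_S n k g Hg) as Hg'. pose proof (Ck_S n k h Hh) as Hh'.
    destruct Hg as [Hg1 Hg2], Hh as [Hh1 Hh2].
    assert (H : forall i x, derivable_pt_lim
        (fun t => (fun x => g x * h x) (vadd x (vscal t (ebasis i)))) 0
        (pderiv g i x * h x + g x * pderiv h i x)).
    { intros i x.
      pose proof (derivable_pt_lim_mult (fun t => g (vadd x (vscal t (ebasis i))))
        (fun t => h (vadd x (vscal t (ebasis i)))) 0 _ _
        (pderiv_spec _ _ _ _ (Hg1 i x)) (pderiv_spec _ _ _ _ (Hh1 i x))) as H.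
      cbv beta in H; rewrite vadd_scal0 in H. exact H. }
    split; [intros i x; eexists; apply H|]. intros i.
    replace (pderiv (fun x => g x * h x) i)
      with (fun x => pderiv g i x * h x + g x * pderiv h i x).
    { apply Ck_plus; apply IH; auto. }
    apply functional_extensionality; intros x. symmetry. apply pderiv_eq, H.
Qed.

Lemma Ck_sumFin n k m (g : Fin.t m -> vec n -> R) :
  (forall i, Ck k (g i)) -> Ck k (fun x => sumFin m (fun i => g i x)).
Proof.
  induction m as [|m IH]; intros H; simpl.
  - apply Ck_const.
  - apply Ck_plus; [apply H|]. apply (IH (fun i => g (Fin.FS i))). intros; apply H.
Qed.

Lemma Ck_Lie n k (f : vec n -> vec n) W : CkV k f -> Ck (S k) W -> Ck k (Lie f W).
Proof.
  intros Hf [_ HW]. apply Ck_sumFin. intros i. apply Ck_mult; [apply HW|apply Hf].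
Qed.

(** Each Lie derivative costs one order of smoothness. The extreme case [i = S p], mere continuity,
    is what bounds the Taylor remainder along the flow. *)
Lemma Ck_LieIter n p (f : vec n -> vec n) W i : (i <= S p)%nat ->
  CkV p f -> Ck (S p) W -> Ck (S p - i) (LieIter f i W).
Proof.
  intros Hi Hf HW. induction i as [|i IH].
  - exact HW.
  - apply Ck_Lie.
    + intros j. apply Ck_le with p; [lia|]. apply Hf.
    + replace (S (S p - S i)) with (S p - i)%nat by lia. apply IH. lia.
Qed.

Lemma Dwithin_cont (S : R -> Prop) g t l : Dwithin S g t l -> cont_within S g t.
Proof.
  intros H eps He. destruct (H 1 ltac:(lra)) as (d & Hd & H1).
  pose proof (Rabs_pos l) as Hl.
  assert (Hq : 0 < eps / (Rabs l + 1)) by (apply Rdiv_lt_0_compat; lra).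
  exists (Rmin d (eps / (Rabs l + 1))). split; [apply Rmin_pos; lra|].
  intros y Hy Hyt.
  pose proof (Rmin_l d (eps / (Rabs l + 1))). pose proof (Rmin_r d (eps / (Rabs l + 1))).
  destruct (Req_dec y t) as [->|Hne]; [rewrite Rminus_eq_0, Rabs_R0; lra|].
  specialize (H1 (y - t) ltac:(lra) ltac:(lra)).
  replace (t + (y - t)) with y in H1 by ring. specialize (H1 Hy).
  set (q := (g y - g t) / (y - t)) in *.
  replace (g y - g t) with (q * (y - t)) by (unfold q; field; lra).
  rewrite Rabs_mult.
  assert (Hq1 : Rabs q < Rabs l + 1).
  { replace q with ((q - l) + l) by ring. eapply Rle_lt_trans; [apply Rabs_triang|]. lra. }
  pose proof (Rabs_pos q).
  apply Rle_lt_trans with ((Rabs l + 1) * Rabs (y - t)).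
  - apply Rmult_le_compat_r; [apply Rabs_pos|lra].
  - apply Rmult_lt_reg_r with (/ (Rabs l + 1)); [apply Rinv_0_lt_compat; lra|].
    replace ((Rabs l + 1) * Rabs (y - t) * / (Rabs l + 1)) with (Rabs (y - t))
      by (field; lra).
    unfold Rdiv in *. lra.
Qed.

Lemma Dwithin_limit1_in S g t l :
  Dwithin S g t l <->
  limit1_in (fun h => (g (t + h) - g t) / h) (fun h => h <> 0 /\ S (t + h)) l 0.
Proof.
  split; intros H eps He; destruct (H eps He) as (d & Hd & Hh); exists d; (split; [easy|]).
  - intros h [[Hh0 HS] Hhd]. apply Hh; try easy.
    simpl in Hhd. unfold Rdist in Hhd. now rewrite Rminus_0_r in Hhd.
  - intros h Hh0 Hhd HS. apply (Hh h). split; [easy|].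
    simpl. unfold Rdist. now rewrite Rminus_0_r.
Qed.

Lemma limit1_in_sumFin n (F : R -> Fin.t n -> R) l D x0 :
  (forall i, limit1_in (fun h => F h i) D (l i) x0) ->
  limit1_in (fun h => sumFin n (F h)) D (sumFin n l) x0.
Proof.
  induction n as [|n IH]; intros H; simpl.
  - intros eps He. exists 1. split; [lra|]. intros. simpl. now rewrite Rdist_eq.
  - apply limit_plus; [apply H|].
    apply (IH (fun h i => F h (Fin.FS i)) (fun i => l (Fin.FS i))). intros; apply H.
Qed.

Lemma cont_within_fin_uniform n (S : R -> Prop) (y : R -> vec n) t :
  (forall k, cont_within S (fun s => y s k) t) ->
  forall eps, 0 < eps -> exists d, 0 < d /\
    forall s, S s -> Rabs (s - t) < d -> forall k, Rabs (y s k - y t k) < eps.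
Proof.
  intros H eps He. induction n as [|n IH].
  { exists 1. split; [lra|]. intros s _ _ k; inversion k. }
  destruct (IH (fun s k => y s (Fin.FS k)) (fun k => H _)) as (d & Hd & H1).
  destruct (H Fin.F1 eps He) as (e & He' & H2).
  exists (Rmin d e). split; [apply Rmin_pos; easy|]. intros s Hs Hst k.
  pose proof (Rmin_l d e). pose proof (Rmin_r d e).
  apply (Fin.caseS' k); [apply H2; [easy|lra] | intros j; apply (H1 s Hs); lra].
Qed.

Lemma cont_within_compose n (S : R -> Prop) (g : vec n -> R) (y : R -> vec n) t :
  (forall k, cont_within S (fun s => y s k) t) -> cont_at g (y t) ->
  cont_within S (fun s => g (y s)) t.
Proof.
  intros Hy Hg eps He. destruct (proj1 (cont_at_coord _ _ _) Hg eps He) as (d & Hd & H1).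
  destruct (cont_within_fin_uniform n S y t Hy d Hd) as (e & He' & H2).
  exists e. split; [easy|]. intros s Hs Hst. apply H1. now apply H2.
Qed.

(** By the mean value formula the difference quotient of [W] along [y] is a sum of partial
    derivatives at intermediate points times difference quotients of [y]. The intermediate points
    lie in the box spanned by [y t] and [y (t + h)], hence tend to [y t]. *)
Lemma Dwithin_chain n (S : R -> Prop) (W : vec n -> R) (y : R -> vec n) (y' : vec n) t :
  Ck 1 W -> (forall k, Dwithin S (fun s => y s k) t (y' k)) ->
  Dwithin S (fun s => W (y s)) t (sumFin n (fun k => pderiv W k (y t) * y' k)).
Proof.
  intros HW Hy.
  destruct (functional_choice _ (fun h => Ck1_mean_value n W HW (y t) (y (t + h)))) as [xi Hxi].
  apply Dwithin_limit1_in.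
  assert (Hlim : limit1_in
    (fun h => sumFin n (fun k => pderiv W k (xi h k) * ((y (t + h) k - y t k) / h)))
    (fun h => h <> 0 /\ S (t + h)) (sumFin n (fun k => pderiv W k (y t) * y' k)) 0).
  { apply (limit1_in_sumFin n (fun h k => pderiv W k (xi h k) * ((y (t + h) k - y t k) / h))
             (fun k => pderiv W k (y t) * y' k)).
    intros i. apply limit_mul.
    - intros eps He.
      assert (Hc : cont_at (pderiv W i) (y t)) by apply HW.
      destruct (proj1 (cont_at_coord _ _ _) Hc eps He) as (d & Hd & H1).
      destruct (cont_within_fin_uniform n S y t) with (eps := d) as (e & He' & H2); [|easy|].
      { intros k. eapply Dwithin_cont, Hy. }
      exists e. split; [easy|]. intros h [[Hh0 HS] Hhe].
      simpl in Hhe. unfold Rdist in Hhe. simpl. unfold Rdist. apply H1. intros k.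
      destruct (Hxi h) as [Hb _]. specialize (Hb i k).
      specialize (H2 (t + h) HS). 
      assert (Hk : Rabs (y (t + h) k - y t k) < d).
      { apply H2. now replace (t + h - t) with (h - 0) by ring. }
      revert Hb. apply Rabs_def2 in Hk. unfold Rmin, Rmax.
      destruct (Rle_dec (y t k) (y (t + h) k)); intros; apply Rabs_def1; lra.
    - apply (proj1 (Dwithin_limit1_in S (fun s => y s i) t (y' i))), Hy. }
  intros eps He. destruct (Hlim eps He) as (d & Hd & H). exists d. split; [easy|].
  intros h Hh. specialize (H h Hh). destruct Hh as [[Hh0 _] _].
  simpl in *. destruct (Hxi h) as [_ Heq]. rewrite Heq.
  replace (sumFin n (fun i => pderiv W i (xi h i) * (y (t + h) i - y t i)) / h)
    with (sumFin n (fun k => pderiv W k (xi h k) * ((y (t + h) k - y t k) / h))); [easy|].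
  unfold Rdiv. rewrite (Rmult_comm (sumFin _ _)), <- sumFin_scal.
  apply sumFin_ext. intros; ring.
Qed.

Lemma Dwithin_Lie n (S : R -> Prop) (f : vec n -> vec n) (W : vec n -> R) (y : R -> vec n) t :
  Ck 1 W -> (forall k, Dwithin S (fun s => y s k) t (f (y t) k)) ->
  Dwithin S (fun s => W (y s)) t (Lie f W (y t)).
Proof. apply Dwithin_chain. Qed.

(** * Calculus on a closed interval *)

Lemma cont_within_limit1_in S g t : cont_within S g t <-> limit1_in g S (g t) t.
Proof.
  split; intros H eps He; destruct (H eps He) as (d & Hd & H'); exists d; (split; [easy|]).
  - intros y [Hy Hyt]. now apply H'.
  - intros y Hy Hyt. now apply H'.
Qed.

Lemma cont_within_plus S g h t :
  cont_within S g t -> cont_within S h t -> cont_within S (fun s => g s + h s) t.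
Proof. rewrite !cont_within_limit1_in. intros; now apply limit_plus. Qed.

Lemma cont_within_minus S g h t :
  cont_within S g t -> cont_within S h t -> cont_within S (fun s => g s - h s) t.
Proof. rewrite !cont_within_limit1_in. intros; now apply limit_minus. Qed.

Lemma cont_within_mult S g h t :
  cont_within S g t -> cont_within S h t -> cont_within S (fun s => g s * h s) t.
Proof. rewrite !cont_within_limit1_in. intros; now apply limit_mul. Qed.

Lemma cont_within_comp (S S' : R -> Prop) g q t : (forall s, S s -> S' (g s)) ->
  cont_within S g t -> cont_within S' q (g t) -> cont_within S (fun s => q (g s)) t.
Proof.
  intros HS Hg Hq eps He. destruct (Hq eps He) as (d & Hd & H1).
  destruct (Hg d Hd) as (e & He' & H2). exists e. split; [easy|].
  intros y Hy Hyt. apply H1; auto.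
Qed.

Lemma cont_within_of_continuity S g t : continuity_pt g t -> cont_within S g t.
Proof.
  intros H eps He. destruct (proj1 (continuity_pt_locally g t) H (mkposreal eps He)) as [d Hd].
  exists d. split; [apply cond_pos|]. intros y _ Hy. now apply (Hd y).
Qed.

(** The nonexpansive projection onto [[a, b]]. Composing with it extends a function from the
    interval to the line, where two-sided theorems apply; it also builds the cutoff for the vector
    field. *)
Definition clamp (a b t : R) : R := Rmax a (Rmin b t).

Lemma clamp_bounds a b t : a <= b -> a <= clamp a b t <= b.
Proof. unfold clamp, Rmax, Rmin. intros. destruct Rle_dec; destruct Rle_dec; lra. Qed.

Lemma clamp_id a b t : a <= t <= b -> clamp a b t = t.
Proof. unfold clamp, Rmax, Rmin. intros. destruct Rle_dec; destruct Rle_dec; lra. Qed.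

Lemma clamp_lipschitz a b s t : Rabs (clamp a b s - clamp a b t) <= Rabs (s - t).
Proof.
  unfold clamp, Rmax, Rmin.
  repeat destruct Rle_dec; unfold Rabs; repeat destruct Rcase_abs; lra.
Qed.

Lemma cont_within_clamp T g : 0 <= T ->
  (forall t, Icc 0 T t -> cont_within (Icc 0 T) g t) ->
  forall t, continuity_pt (fun s => g (clamp 0 T s)) t.
Proof.
  intros HT Hg t. apply continuity_pt_locally. intros eps.
  destruct (Hg (clamp 0 T t) (clamp_bounds 0 T t HT) eps (cond_pos eps)) as (d & Hd & H).
  exists (mkposreal d Hd). intros s Hs. apply H; [apply clamp_bounds, HT|].
  eapply Rle_lt_trans; [apply clamp_lipschitz|exact Hs].
Qed.

Lemma cont_within_bounded T g : 0 <= T ->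
  (forall t, Icc 0 T t -> cont_within (Icc 0 T) g t) ->
  exists B, 0 <= B /\ forall t, Icc 0 T t -> Rabs (g t) <= B.
Proof.
  intros HT Hg.
  destruct (continuity_ab_maj (fun s => Rabs (g (clamp 0 T s))) 0 T HT) as (m & Hm & _).
  { intros c _. apply (continuity_pt_comp (fun s => g (clamp 0 T s)) Rabs);
      [now apply cont_within_clamp|apply Rcontinuity_abs]. }
  eexists. split; [|intros t Ht; specialize (Hm t Ht); simpl in Hm].
  2: { rewrite (clamp_id 0 T t Ht) in Hm. exact Hm. }
  apply Rabs_pos.
Qed.

(** The clamped extension of [g] is continuous on the line and has a two-sided derivative in the
    open interval, which is what the mean value theorem asks for. *)
Lemma Dwithin_monotone T g g' : 
  (forall t, Icc 0 T t -> Dwithin (Icc 0 T) g t (g' t)) ->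
  (forall t, Icc 0 T t -> 0 <= g' t) ->
  forall h, Icc 0 T h -> g 0 <= g h.
Proof.
  intros Hg Hpos h [Hh0 HhT].
  assert (HT : 0 <= T) by lra.
  destruct (MVT_gen (fun s => g (clamp 0 T s)) 0 h (fun s => g' (clamp 0 T s))) as (c & Hc & Heq).
  - rewrite Rmin_left, Rmax_right by lra. intros x Hx. apply is_derive_Reals.
    intros eps He. rewrite (clamp_id 0 T x) by lra.
    destruct (Hg x ltac:(unfold Icc; lra) eps He) as (d & Hd & H).
    assert (Hm : 0 < Rmin d (Rmin x (T - x))) by (repeat apply Rmin_pos; lra).
    exists (mkposreal _ Hm). intros k Hk Hkd. simpl in Hkd.
    pose proof (Rmin_l d (Rmin x (T - x))). pose proof (Rmin_r d (Rmin x (T - x))).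
    pose proof (Rmin_l x (T - x)). pose proof (Rmin_r x (T - x)).
    assert (Hb : Icc 0 T (x + k)) by (apply Rabs_def2 in Hkd; unfold Icc; lra).
    rewrite clamp_id by apply Hb. apply H; [easy|lra|easy].
  - intros x _. apply cont_within_clamp; [easy|]. intros t Ht.
    eapply Dwithin_cont, Hg, Ht.
  - rewrite !clamp_id in Heq by lra.
    pose proof (Hpos (clamp 0 T c) (clamp_bounds 0 T c HT)). nra.
Qed.

Lemma Dwithin_of_derivable S g t l : derivable_pt_lim g t l -> Dwithin S g t l.
Proof.
  intros H eps He. destruct (H eps He) as [d Hd]. exists d. split; [apply cond_pos|].
  intros h Hh Hhd _. now apply Hd.
Qed.

Lemma Dwithin_minus S g h t l m :
  Dwithin S g t l -> Dwithin S h t m -> Dwithin S (fun s => g s - h s) t (l - m).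
Proof.
  intros Hg Hh eps He.
  destruct (Hg (eps / 2) ltac:(lra)) as (d & Hd & H1).
  destruct (Hh (eps / 2) ltac:(lra)) as (e & He' & H2).
  exists (Rmin d e). split; [apply Rmin_pos; easy|]. intros k Hk Hkd HS.
  pose proof (Rmin_l d e). pose proof (Rmin_r d e).
  specialize (H1 k Hk ltac:(lra) HS). specialize (H2 k Hk ltac:(lra) HS).
  replace ((g (t + k) - h (t + k) - (g t - h t)) / k - (l - m))
    with (((g (t + k) - g t) / k - l) - ((h (t + k) - h t) / k - m)) by (field; easy).
  eapply Rle_lt_trans; [apply Rabs_triang|]. rewrite Rabs_Ropp. lra.
Qed.

(** * Taylor bounds and comparison of coefficients *)

Definition taylor_poly (m : nat) (a : nat -> R) (h : R) : R :=
  sum_f_R0 (fun i => a i * h ^ i / INR (fact i)) m.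

Lemma taylor_poly_derive m : forall a h,
  derivable_pt_lim (taylor_poly (S m) a) h (taylor_poly m (fun i => a (S i)) h).
Proof.
  assert (Hmono : forall i a h, derivable_pt_lim (fun h => a * h ^ S i / INR (fact (S i))) h
            (a * h ^ i / INR (fact i))).
  { intros i a h.
    pose proof (INR_fact_neq_0 i). pose proof (pos_INR i).
    replace (a * h ^ i / INR (fact i))
      with (a / INR (fact (S i)) * (INR (S i) * h ^ pred (S i)))
      by (rewrite fact_simpl, mult_INR, S_INR; simpl pred; field; lra).
    eapply derivable_pt_lim_ext;
      [|apply (derivable_pt_lim_scal (fun y => y ^ S i)), derivable_pt_lim_pow].
    intros y. unfold mult_real_fct. unfold Rdiv. ring. }
  induction m as [|m IH]; intros a h.
  - unfold taylor_poly. simpl.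
    replace (a 1%nat * 1 / 1) with (0 + (a 1%nat * 1 / 1)) by ring.
    apply (derivable_pt_lim_plus (fun _ => _) (fun _ => _)).
    + apply derivable_pt_lim_const.
    + exact (Hmono 0%nat (a 1%nat) h).
  - change (derivable_pt_lim
      (fun h => taylor_poly (S m) a h + a (S (S m)) * h ^ S (S m) / INR (fact (S (S m)))) h
      (taylor_poly m (fun i => a (S i)) h + a (S (S m)) * h ^ S m / INR (fact (S m)))).
    apply (derivable_pt_lim_plus (taylor_poly (S m) a)
      (fun h => a (S (S m)) * h ^ S (S m) / INR (fact (S (S m))))); [apply IH|apply Hmono].
Qed.

Lemma taylor_poly_at0 m a : taylor_poly m a 0 = a 0%nat.
Proof.
  induction m as [|m IH]; unfold taylor_poly in *; [simpl; field|].
  rewrite tech5, IH. simpl. unfold Rdiv. ring.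
Qed.

(** The top coefficient [a m] is a bound for [d m], the others are values at 0. The bound for [d 1]
    makes the polynomial minus [d 0] nondecreasing, and this difference vanishes at 0. *)
Lemma taylor_upper T m : forall (d : nat -> R -> R) (a : nat -> R),
  (forall i t, (i < m)%nat -> Icc 0 T t -> Dwithin (Icc 0 T) (d i) t (d (S i) t)) ->
  (forall i, (i < m)%nat -> d i 0 = a i) ->
  (forall t, Icc 0 T t -> d m t <= a m) ->
  forall h, Icc 0 T h -> d 0%nat h <= taylor_poly m a h.
Proof.
  induction m as [|m IH]; intros d a Hd Ha Hm h Hh.
  { specialize (Hm h Hh). unfold taylor_poly; simpl. lra. }
  pose proof (IH (fun i => d (S i)) (fun i => a (S i))) as H1.
  specialize (H1 ltac:(intros; apply Hd; [lia|easy]) ltac:(intros; apply Ha; lia) Hm).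
  pose proof (Dwithin_monotone T (fun s => taylor_poly (S m) a s - d 0%nat s)
    (fun s => taylor_poly m (fun i => a (S i)) s - d 1%nat s)) as H2.
  specialize (H2 ltac:(intros t Ht; apply Dwithin_minus;
    [apply Dwithin_of_derivable, taylor_poly_derive|apply Hd; [lia|easy]])).
  specialize (H2 ltac:(intros t Ht; specialize (H1 t Ht); simpl in H1; lra) h Hh).
  simpl in H2. rewrite taylor_poly_at0, (Ha 0%nat) in H2 by lia. lra.
Qed.

Lemma eq0_of_small x E T : 0 < T -> (forall h, 0 < h <= T -> Rabs x <= E * h) -> x = 0.
Proof.
  intros HT H. destruct (Req_dec x 0) as [|Hx]; [easy|]. exfalso.
  apply Rabs_pos_lt in Hx. pose proof (Rabs_pos E) as HE. pose proof (Rle_abs E) as HE2.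
  set (h := Rmin T (Rabs x / (2 * (Rabs E + 1)))).
  assert (Hq : 0 < Rabs x / (2 * (Rabs E + 1))) by (apply Rdiv_lt_0_compat; lra).
  assert (Hh : 0 < h) by (apply Rmin_pos; easy).
  pose proof (Rmin_l T (Rabs x / (2 * (Rabs E + 1)))) as H1.
  pose proof (Rmin_r T (Rabs x / (2 * (Rabs E + 1)))) as H2. fold h in H1, H2.
  specialize (H h ltac:(lra)).
  assert ((Rabs E + 1) * h <= (Rabs E + 1) * (Rabs x / (2 * (Rabs E + 1))))
    by (apply Rmult_le_compat_l; lra).
  replace ((Rabs E + 1) * (Rabs x / (2 * (Rabs E + 1)))) with (Rabs x / 2) in * by (field; lra).
  nra.
Qed.

(** Letting [h] tend to 0 kills the constant term; then one factor [h] is divided out and the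
    argument repeats. *)
Lemma poly_coef_eq0 m : forall (c : nat -> R) C T, 0 < T ->
  (forall h, 0 < h <= T -> Rabs (sum_f_R0 (fun i => c i * h ^ i) m) <= C * h ^ S m) ->
  forall i, (i <= m)%nat -> c i = 0.
Proof.
  induction m as [|m IH]; intros c C T HT H i Hi.
  - replace i with 0%nat by lia. apply eq0_of_small with C T; [easy|]. intros h Hh.
    specialize (H h Hh). simpl in H. rewrite !Rmult_1_r in H. exact H.
  - assert (Hdec : forall h, sum_f_R0 (fun i => c i * h ^ i) (S m)
        = c 0%nat + h * sum_f_R0 (fun i => c (S i) * h ^ i) m).
    { intros h. rewrite decomp_sum by lia. simpl pred. rewrite scal_sum.
      simpl. rewrite Rmult_1_r. f_equal. apply sum_eq. intros; ring. }
    set (E := sum_f_R0 (fun i => Rabs (c (S i))) m).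
    assert (H0 : c 0%nat = 0).
    { apply eq0_of_small with (Rabs C + E) (Rmin 1 T); [apply Rmin_pos; lra|].
      intros h [Hh Hhm]. pose proof (Rmin_l 1 T). pose proof (Rmin_r 1 T).
      specialize (H h ltac:(lra)). rewrite Hdec in H.
      assert (Hpow : forall k, 0 <= h ^ k <= 1).
      { intros k. split; [apply pow_le; lra|].
        rewrite <- (pow1 k). apply pow_incr; lra. }
      assert (HE : Rabs (sum_f_R0 (fun i => c (S i) * h ^ i) m) <= E).
      { eapply Rle_trans; [apply Rsum_abs|]. apply sum_Rle. intros k _.
        rewrite Rabs_mult. rewrite (Rabs_right (h ^ k)) by (apply Rle_ge, Hpow).
        pose proof (Rabs_pos (c (S k))). specialize (Hpow k). nra. }
      assert (HC : C * h ^ S (S m) <= Rabs C * h).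
      { specialize (Hpow (S m)). pose proof (Rle_abs C). pose proof (Rabs_pos C).
        change (h ^ S (S m)) with (h * h ^ S m). 
        assert (0 <= h * h ^ S m <= h) by nra. nra. }
      set (q := sum_f_R0 (fun i => c (S i) * h ^ i) m) in *.
      replace (c 0%nat) with ((c 0%nat + h * q) - h * q) by ring.
      eapply Rle_trans; [apply Rabs_triang|]. rewrite Rabs_Ropp, Rabs_mult, (Rabs_right h) by lra.
      nra. }
    destruct i as [|i]; [easy|].
    apply (IH (fun i => c (S i)) C T HT); [|lia]. intros h Hh. specialize (H h Hh).
    rewrite Hdec, H0, Rplus_0_l, Rabs_mult, (Rabs_right h) in H by lra.
    apply Rmult_le_reg_l with h; [lra|]. eapply Rle_trans; [exact H|]. simpl. right; ring.
Qed.

(** The top derivative is bounded by continuity, so [D 0] differs from its Taylor polynomial of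
    degree [m] by [O(h ^ S m)]. As [D 0] is itself of that size, so is the polynomial, and its
    coefficients vanish. *)
Lemma taylor_coef_eq0 T m (D : nat -> R -> R) C : 0 < T ->
  (forall i t, (i < S m)%nat -> Icc 0 T t -> Dwithin (Icc 0 T) (D i) t (D (S i) t)) ->
  (forall t, Icc 0 T t -> cont_within (Icc 0 T) (D (S m)) t) ->
  (forall h, Icc 0 T h -> Rabs (D 0%nat h) <= C * h ^ S m) ->
  forall i, (i <= m)%nat -> D i 0 = 0.
Proof.
  intros HT HD Hc HC.
  destruct (cont_within_bounded T (D (S m)) ltac:(lra) Hc) as (B & HB0 & HB).
  (* The sign [e = 1] serves the upper bound for [D 0]; [e = -1], after negation of everything,
     serves the lower bound. *)
  set (a e i := if Nat.eqb i (S m) then e * B else D i 0).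
  assert (Ha : forall e i, (i < S m)%nat -> a e i = D i 0).
  { intros e i Hi. unfold a. now rewrite (proj2 (Nat.eqb_neq _ _)) by lia. }
  assert (Hat : forall e, a e (S m) = e * B).
  { intros e. unfold a. now rewrite Nat.eqb_refl. }
  assert (Hpoly : forall e h, taylor_poly (S m) (a e) h
            = taylor_poly m (fun i => D i 0) h + e * B * h ^ S m / INR (fact (S m))).
  { intros e h. unfold taylor_poly. rewrite tech5, Hat. f_equal. apply sum_eq.
    intros i Hi. now rewrite Ha by lia. }
  assert (Hf : forall i, 0 < INR (fact i)) by (intros; apply INR_fact_lt_0).
  assert (H : forall h, 0 < h <= T -> Rabs (taylor_poly m (fun i => D i 0) h)
            <= (C + B / INR (fact (S m))) * h ^ S m).
  { intros h Hh. assert (Hh' : Icc 0 T h) by (unfold Icc; lra).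
    pose proof (taylor_upper T (S m) D (a 1) HD) as H1.
    specialize (H1 ltac:(intros; now rewrite Ha)).
    specialize (H1 ltac:(intros t Ht; rewrite Hat; specialize (HB t Ht);
      apply Rabs_le_between in HB; lra) h Hh').
    pose proof (taylor_upper T (S m) (fun i t => 0 - D i t) (fun i => - a (-1) i)) as H2.
    specialize (H2 ltac:(intros i t Hi Ht; simpl;
      apply Dwithin_minus; [apply Dwithin_of_derivable, derivable_pt_lim_const|now apply HD])).
    specialize (H2 ltac:(intros; simpl; rewrite Ha by easy; ring)).
    specialize (H2 ltac:(intros t Ht; simpl; rewrite Hat; specialize (HB t Ht);
      apply Rabs_le_between in HB; lra) h Hh').
    assert (Hneg : taylor_poly (S m) (fun i => - a (-1) i) h = - taylor_poly (S m) (a (-1)) h).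
    { unfold taylor_poly. rewrite <- (Rmult_1_l (sum_f_R0 (fun i => a _ i * _ / _) _)).
      rewrite Ropp_mult_distr_l, scal_sum. apply sum_eq. intros. field.
      apply Rgt_not_eq, Hf. }
    rewrite Hneg, Hpoly in H2. rewrite Hpoly in H1.
    specialize (HC h Hh'). apply Rabs_le_between in HC. apply Rabs_le.
    unfold Rdiv in *. nra. }
  intros i Hi.
  assert (Hi0 : D i 0 / INR (fact i) = 0).
  { apply (poly_coef_eq0 m (fun i => D i 0 / INR (fact i)) (C + B / INR (fact (S m))) T HT);
      [|easy].
    intros h Hh. specialize (H h Hh). unfold taylor_poly in H.
    erewrite sum_eq; [exact H|]. intros. simpl. unfold Rdiv. ring. }
  specialize (Hf i). 
  replace (D i 0) with (D i 0 / INR (fact i) * INR (fact i)) by (field; lra).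
  rewrite Hi0; ring.
Qed.

(** [Ck_within] differentiates on the inside of its recursion and [nderiv_within] on the outside;
    commuting the iteration reconciles them. *)
Lemma nderiv_within_spec S k : forall g, Ck_within S k g ->
  (forall i t, (i < k)%nat -> S t ->
    Dwithin S (nderiv_within S i g) t (nderiv_within S (Datatypes.S i) g t)) /\
  (forall t, S t -> cont_within S (nderiv_within S k g) t).
Proof.
  induction k as [|k IH]; intros g Hg.
  - split; [lia|exact Hg].
  - destruct Hg as [H1 H2]. destruct (IH _ H2) as [H3 H4].
    assert (Heq : forall i, nderiv_within S (Datatypes.S i) g = nderiv_within S i (deriv_within S g)).
    { intros i. unfold nderiv_within. apply Nat.iter_succ_r. }
    split.
    + intros i t Hi Ht. rewrite Heq. destruct i as [|i].
      * simpl. unfold deriv_within. apply epsilon_spec. now apply H1.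
      * rewrite Heq. apply H3; [lia|easy].
    + intros t Ht. rewrite Heq. now apply H4.
Qed.

(** * Existence of solutions under a Lyapunov function *)

Lemma half_pow_small C eps : 0 < eps -> exists m, C * (/ 2) ^ m < eps.
Proof.
  intros He. pose proof (Rabs_pos C) as HC.
  destruct (pow_lt_1_zero (/ 2)) with (y := eps / (Rabs C + 1)) as [m Hm].
  - rewrite Rabs_right; lra.
  - apply Rdiv_lt_0_compat; lra.
  - exists m. specialize (Hm m (le_n m)).
    assert (Hp : 0 < (/ 2) ^ m) by (apply pow_lt; lra).
    rewrite Rabs_right in Hm by lra.
    apply Rle_lt_trans with ((Rabs C + 1) * (/ 2) ^ m).
    + pose proof (Rle_abs C). nra.
    + apply Rmult_lt_reg_r with (/ (Rabs C + 1)); [apply Rinv_0_lt_compat; lra|].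
      replace ((Rabs C + 1) * (/ 2) ^ m * / (Rabs C + 1)) with ((/ 2) ^ m)
        by (field; lra).
      exact Hm.
Qed.

Lemma le_of_half_pow x y C : (forall m, x <= y + C * (/ 2) ^ m) -> x <= y.
Proof.
  intros H. destruct (Rle_or_lt x y) as [|Hlt]; [easy|].
  destruct (half_pow_small C (x - y) ltac:(lra)) as [m Hm]. specialize (H m). lra.
Qed.

Lemma geometric_limit (u : nat -> R) C :
  (forall m, Rabs (u (S m) - u m) <= C * (/ 2) ^ m) ->
  exists l, forall m, Rabs (u m - l) <= 2 * C * (/ 2) ^ m.
Proof.
  intros H.
  (* From index [m] on the sequence moves by at most the geometric tail [2 * C * (/ 2) ^ m], so
     these intervals are nested. *)
  set (a m := u m - 2 * C * (/ 2) ^ m). set (b m := u m + 2 * C * (/ 2) ^ m).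
  assert (Hab : forall m, a m <= b m).
  { intros m. unfold a, b. specialize (H m). pose proof (Rabs_pos (u (S m) - u m)). lra. }
  assert (Ha : forall k m, a m <= a (k + m)%nat).
  { induction k as [|k IH]; intros m; simpl; [lra|]. eapply Rle_trans; [apply IH|].
    unfold a. specialize (H (k + m)%nat). apply Rabs_le_between in H. simpl. lra. }
  assert (Hb : forall k m, b (k + m)%nat <= b m).
  { induction k as [|k IH]; intros m; simpl; [lra|]. eapply Rle_trans; [|apply IH].
    unfold b. specialize (H (k + m)%nat). apply Rabs_le_between in H. simpl. lra. }
  assert (Hjm : forall j m, a j <= b m).
  { intros j m. eapply Rle_trans; [apply (Ha m)|]. eapply Rle_trans; [apply Hab|].
    rewrite Nat.add_comm. apply Hb. }
  destruct (completeness (fun y => exists j, y = a j)) as [l [Hl1 Hl2]].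
  - exists (b 0%nat). intros y [j ->]. apply Hjm.
  - exists (a 0%nat). now exists 0%nat.
  - exists l. intros m. apply Rabs_le.
    assert (a m <= l) by (apply Hl1; now exists m).
    assert (l <= b m) by (apply Hl2; intros y [j ->]; apply Hjm).
    unfold a, b in *. lra.
Qed.

(** * Picard iteration for bounded globally Lipschitz fields *)

Definition lip_curve {n} (B : R) (z : R -> vec n) : Prop :=
  forall s t k, Rabs (z s k - z t k) <= B * Rabs (s - t).

Definition lip_field {n} (L : R) (F : vec n -> vec n) : Prop :=
  forall x y i, Rabs (F x i - F y i) <= L * sumFin n (fun k => Rabs (x k - y k)).

(* The integrand reads [z] at [Rabs s], so that the iteration makes sense on the
   whole line while only nonnegative times matter. *)
Definition picard {n} (F : vec n -> vec n) (x : vec n) (z : R -> vec n) : R -> vec n :=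
  fun t k => x k + RInt (fun s => F (z (Rabs s)) k) 0 t.

Section Picard.
Context {n : nat} (F : vec n -> vec n) (x : vec n) (L B : R).
Hypotheses (HL0 : 0 <= L) (HB0 : 0 <= B).
Hypothesis HL : lip_field L F.
Hypothesis HB : forall y i, Rabs (F y i) <= B.

Lemma picard_integrand_cont z k t :
  lip_curve B z -> continuous (fun s => F (z (Rabs s)) k) t.
Proof.
  intros Hz. apply continuity_pt_filterlim, continuity_pt_locally. intros eps.
  set (C := L * (INR n * B) + 1).
  pose proof (pos_INR n).
  assert (HC : 0 < C) by (unfold C; pose proof (Rmult_le_pos L (INR n * B)); nra).
  assert (Hd : 0 < eps / C) by (apply Rdiv_lt_0_compat; [apply cond_pos|easy]).
  exists (mkposreal _ Hd). intros s Hs.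
  assert (Hs' : Rabs (s - t) < eps / C) by exact Hs.
  eapply Rle_lt_trans; [apply HL|].
  apply Rle_lt_trans with (C * Rabs (s - t)).
  - apply Rle_trans with (L * (INR n * (B * Rabs (s - t)))).
    + apply Rmult_le_compat_l; [easy|]. rewrite <- sumFin_const. apply sumFin_le.
      intros i. eapply Rle_trans; [apply Hz|]. apply Rmult_le_compat_l; [easy|].
      apply Rabs_triang_inv2.
    + unfold C. pose proof (Rabs_pos (s - t)). nra.
  - apply Rmult_lt_reg_r with (/ C); [now apply Rinv_0_lt_compat|].
    replace (C * Rabs (s - t) * / C) with (Rabs (s - t)) by (field; lra). exact Hs'.
Qed.

Lemma picard_derive z k t :
  lip_curve B z -> is_derive (fun s => picard F x z s k) t (F (z (Rabs t)) k).
Proof.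
  intros Hz. unfold picard.
  replace (F (z (Rabs t)) k) with (0 + F (z (Rabs t)) k) by ring.
  apply (is_derive_plus (V := R_NormedModule) (fun _ => x k)); [apply (@is_derive_const R_AbsRing)|].
  apply (is_derive_RInt (V := R_NormedModule) (fun s => F (z (Rabs s)) k) _ 0).
  - apply filter_forall. intros b. apply (RInt_correct (V := R_CompleteNormedModule)).
    apply (ex_RInt_continuous (V := R_CompleteNormedModule)).
    intros; now apply picard_integrand_cont.
  - now apply picard_integrand_cont.
Qed.

Lemma picard_at0 z k : picard F x z 0 k = x k.
Proof. unfold picard. rewrite (RInt_point (V := R_CompleteNormedModule)). apply Rplus_0_r. Qed.

Lemma picard_lip z : lip_curve B z -> lip_curve B (picard F x z).
Proof.
  intros Hz s t k.
  destruct (MVT_gen (fun s => picard F x z s k) t s (fun s => F (z (Rabs s)) k)) as (c & _ & ->).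
  - intros; now apply picard_derive.
  - intros u _. apply derivable_continuous_pt. exists (F (z (Rabs u)) k).
    now apply is_derive_Reals, picard_derive.
  - rewrite Rabs_mult. apply Rmult_le_compat_r; [apply Rabs_pos|apply HB].
Qed.

(* The weight [exp (2 Lam t)] makes the Picard map a contraction with factor 1/2
   on the whole half-line. *)
Let Lam := L * INR n + 1.

Lemma Lam_ge1 : 1 <= Lam.
Proof. unfold Lam. pose proof (pos_INR n). nra. Qed.

Lemma picard_contracts y z D : 0 <= D -> lip_curve B y -> lip_curve B z ->
  (forall t k, 0 <= t -> Rabs (y t k - z t k) <= D * exp (2 * Lam * t)) ->
  forall t k, 0 <= t ->
    Rabs (picard F x y t k - picard F x z t k) <= D / 2 * exp (2 * Lam * t).
Proof.
  intros HD Hy Hz H t k Ht.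
  assert (Hder : forall s, 0 <= s ->
    Rabs (F (y (Rabs s)) k - F (z (Rabs s)) k) <= D * Lam * exp (2 * Lam * s)).
  { intros s Hs. rewrite (Rabs_right s) by lra. eapply Rle_trans; [apply HL|].
    apply Rle_trans with (L * (INR n * (D * exp (2 * Lam * s)))).
    - apply Rmult_le_compat_l; [easy|]. rewrite <- sumFin_const. apply sumFin_le.
      intros i. now apply H.
    - unfold Lam at 2. pose proof (exp_pos (2 * Lam * s)). nra. }
  assert (Hexp : forall s, derivable_pt_lim (fun s => D / 2 * exp (2 * Lam * s)) s
                  (D * Lam * exp (2 * Lam * s))).
  { intros s. apply is_derive_Reals. auto_derive; [easy|]. field. }
  (* A one-sided estimate, applied below in both orders of [y] and [z]. The derivative
     [D * Lam * exp (2 * Lam * s)] of the claimed bound dominates that of the difference, and both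
     start from values that compare at 0. *)
  assert (Hone : forall y z, lip_curve B y -> lip_curve B z ->
    (forall s, 0 <= s -> F (y (Rabs s)) k - F (z (Rabs s)) k <= D * Lam * exp (2 * Lam * s)) ->
    picard F x y t k - picard F x z t k <= D / 2 * exp (2 * Lam * t)).
  { clear y z Hy Hz H Hder. intros y z Hy Hz Hder.
    pose proof (Dwithin_monotone t
      (fun s => D / 2 * exp (2 * Lam * s) - (picard F x y s k - picard F x z s k))
      (fun s => D * Lam * exp (2 * Lam * s) - (F (y (Rabs s)) k - F (z (Rabs s)) k))) as HM.
    specialize (HM ltac:(intros s Hs; apply Dwithin_minus; [apply Dwithin_of_derivable, Hexp|];
      apply Dwithin_minus; apply Dwithin_of_derivable, is_derive_Reals;
      now apply picard_derive)).
    specialize (HM ltac:(intros s Hs; specialize (Hder s (proj1 Hs)); lra) t ltac:(unfold Icc; lra)).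
    simpl in HM. rewrite !picard_at0, Rmult_0_r, exp_0 in HM. lra. }
  apply Rabs_le. split.
  - enough (picard F x z t k - picard F x y t k <= D / 2 * exp (2 * Lam * t)) by lra.
    apply Hone; [easy|easy|]. intros s Hs. specialize (Hder s Hs).
    apply Rabs_le_between in Hder. lra.
  - apply Hone; [easy|easy|]. intros s Hs. specialize (Hder s Hs).
    apply Rabs_le_between in Hder. lra.
Qed.

Lemma picard_lindelof :
  exists z : R -> vec n, z 0 = x /\
    forall t k, 0 <= t -> derivable_pt_lim (fun s => z s k) t (F (z t) k).
Proof.
  pose proof Lam_ge1 as HLam.
  set (zz m := Nat.iter m (picard F x) (fun _ => x)).
  assert (Hlip : forall m, lip_curve B (zz m)).
  { induction m as [|m IH]; [|now apply picard_lip].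
    intros s t k. simpl. rewrite Rminus_eq_0, Rabs_R0. pose proof (Rabs_pos (s - t)). nra. }
  assert (Hstep : forall m t k, 0 <= t ->
    Rabs (zz (S m) t k - zz m t k) <= B * exp (2 * Lam * t) * (/ 2) ^ m).
  { induction m as [|m IH]; intros t k Ht.
    - pose proof (Hlip 1%nat t 0 k) as H1.
      replace (zz 1%nat 0 k) with (x k) in H1 by (symmetry; apply picard_at0).
      eapply Rle_trans; [exact H1|]. rewrite Rminus_0_r, (Rabs_right t) by lra.
      simpl. rewrite Rmult_1_r. apply Rmult_le_compat_l; [easy|].
      pose proof (exp_ineq1_le (2 * Lam * t)). nra.
    - replace (B * exp (2 * Lam * t) * (/ 2) ^ S m)
        with ((B * (/ 2) ^ m) / 2 * exp (2 * Lam * t)) by (simpl; field).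
      apply (picard_contracts (zz (S m)) (zz m)); auto.
      + apply Rmult_le_pos; [easy|]. apply pow_le; lra.
      + intros u j Hu. eapply Rle_trans; [now apply IH|]. right; ring. }
  assert (Hlim : forall tk : R * Fin.t n, exists l, 0 <= fst tk -> forall m,
    Rabs (zz m (fst tk) (snd tk) - l) <= 2 * (B * exp (2 * Lam * fst tk)) * (/ 2) ^ m).
  { intros [t k]. simpl. destruct (Rle_dec 0 t) as [Ht|Ht]; [|exists 0; easy].
    destruct (geometric_limit (fun m => zz m t k) (B * exp (2 * Lam * t))) as [l Hl].
    - intros m. now apply Hstep.
    - now exists l. }
  destruct (functional_choice _ Hlim) as [lim Hlim'].
  set (y t k := lim (Rabs t, k)).
  assert (Hy : forall m t k, 0 <= t ->
    Rabs (zz m t k - y t k) <= (2 * B * (/ 2) ^ m) * exp (2 * Lam * t)).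
  { intros m t k Ht. unfold y. rewrite (Rabs_right t) by lra.
    eapply Rle_trans; [apply (Hlim' (t, k) Ht m)|]. simpl. right; ring. }
  assert (Hylip : lip_curve B y).
  { intros s t k.
    apply Rle_trans with (B * Rabs (Rabs s - Rabs t));
      [|apply Rmult_le_compat_l; [easy|apply Rabs_triang_inv2]].
    apply le_of_half_pow with (2 * B * exp (2 * Lam * Rabs s) + 2 * B * exp (2 * Lam * Rabs t)).
    intros m. 
    pose proof (Hy m (Rabs s) k (Rabs_pos s)) as H1.
    pose proof (Hy m (Rabs t) k (Rabs_pos t)) as H2.
    pose proof (Hlip m (Rabs s) (Rabs t) k) as H3.
    assert (Hyabs : forall u, y (Rabs u) k = y u k) by (intros; unfold y; now rewrite Rabs_Rabsolu).
    rewrite Hyabs in H1, H2.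
    apply Rabs_le_between in H1. apply Rabs_le_between in H2. apply Rabs_le_between in H3.
    apply Rabs_le. lra. }
  (* Both sides are limits of the iterates: the right one by construction, the left one because the
     Picard map contracts. *)
  assert (Hfix : forall t k, 0 <= t -> picard F x y t k = y t k).
  { intros t k Ht.
    assert (Hd : forall m, Rabs (picard F x y t k - y t k)
        <= 0 + 2 * B * exp (2 * Lam * t) * (/ 2) ^ m).
    { intros m.
      pose proof (picard_contracts (zz m) y (2 * B * (/ 2) ^ m)) as H1.
      specialize (H1 ltac:(apply Rmult_le_pos; [lra|apply pow_le; lra]) (Hlip m) Hylip
        ltac:(intros; now apply Hy) t k Ht).
      pose proof (Hy (S m) t k Ht) as H2. simpl in H2.
      change (picard F x (Nat.iter m (picard F x) (fun _ => x)) t k)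
        with (picard F x (zz m) t k) in H2.
      apply Rabs_le_between in H1. apply Rabs_le_between in H2. apply Rabs_le. lra. }
    apply le_of_half_pow in Hd. pose proof (Rabs_pos (picard F x y t k - y t k)).
    apply Rminus_diag_uniq, Rabs_eq_0. lra. }
  (* The limit [y] is even in time and so need not have a two-sided derivative at 0; its Picard
     image agrees with it for nonnegative times and is differentiable everywhere. *)
  exists (picard F x y). split.
  - apply functional_extensionality; intros k. apply picard_at0.
  - intros t k Ht.
    replace (picard F x y t) with (y (Rabs t)).
    + now apply is_derive_Reals, picard_derive.
    + rewrite (Rabs_right t) by lra. apply functional_extensionality; intros j.
      symmetry. now apply Hfix.
Qed.

End Picard.

Lemma fin_uniform_bound m (P : Fin.t m -> R -> Prop) :
  (forall i C C', C <= C' -> P i C -> P i C') -> (forall i, exists C, P i C) ->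
  exists C, 0 <= C /\ forall i, P i C.
Proof.
  intros Hmono H. destruct (functional_choice _ H) as [C HC].
  exists (sumFin m (fun i => Rabs (C i))). split; [apply sumFin_ge0; intros; apply Rabs_pos|].
  intros i. apply Hmono with (C i); [|apply HC].
  eapply Rle_trans; [apply Rle_abs|].
  apply (sumFin_ge_term m (fun i => Rabs (C i))). intros; apply Rabs_pos.
Qed.

(* Cutting [f] off above the level [V x + 1] gives a bounded, globally Lipschitz
   field along which [V] still decreases, so its solution never meets the cutoff. *)
Lemma lyapunov_ode_solution n (f : vec n -> vec n) (V : vec n -> R) x T :
  CkV 1 f -> Ck 1 V ->
  (forall B, exists Rad, forall y, Rad <= vnorm y -> B <= V y) ->
  (forall y, Lie f V y <= 0) ->
  exists z, is_sol_on f x T z.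
Proof.
  intros Hf HV Hrad HLie.
  destruct (Hrad (V x + 1)) as [Rad HRad].
  set (Q := Rmax Rad 0).
  assert (HQ0 : 0 <= Q) by apply Rmax_r.
  assert (HQ : forall y, Q <= vnorm y -> V x + 1 <= V y).
  { intros y Hy. apply HRad. eapply Rle_trans; [apply Rmax_l|exact Hy]. }
  set (c (y : vec n) := (fun k => clamp (- Q) Q (y k)) : vec n).
  (* Equal to 1 up to level [V x], to 0 from level [V x + 1] on, and linear in between. *)
  set (chi v := clamp 0 1 (V x + 1 - v)).
  set (F (y : vec n) := (fun i => chi (V (c y)) * f (c y) i) : vec n).
  assert (Hcbox : forall y k, Rabs (c y k) <= Q).
  { intros y k. apply Rabs_le, clamp_bounds. lra. }
  assert (Hclip : forall y z, sumFin n (fun k => Rabs (c y k - c z k))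
                              <= sumFin n (fun k => Rabs (y k - z k))).
  { intros y z. apply sumFin_le. intros k. apply clamp_lipschitz. }
  destruct (fin_uniform_bound n (fun i C => forall y z,
      Rabs (f (c y) i - f (c z) i) <= C * sumFin n (fun k => Rabs (y k - z k)))) as (Lf & HLf0 & HLf).
  { intros i C C' HC H y z. eapply Rle_trans; [apply H|]. apply Rmult_le_compat_r; [|easy].
    apply sumFin_ge0; intros; apply Rabs_pos. }
  { intros i. destruct (Ck1_lipschitz_on_box n _ Q (Hf i)) as (C & HC & H). exists C.
    intros y z. eapply Rle_trans; [apply H; apply Hcbox|]. apply Rmult_le_compat_l; [lra|apply Hclip]. }
  destruct (fin_uniform_bound n (fun i C => forall y, Rabs (f (c y) i) <= C)) as (Bf & HBf0 & HBf).
  { intros i C C' HC H y. eapply Rle_trans; [apply H|easy]. }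
  { intros i. destruct (bounded_on_box n _ Q (Ck_cont n 1 _ (Hf i))) as (C & HC & H).
    exists C. intros y. apply H, Hcbox. }
  destruct (Ck1_lipschitz_on_box n V Q HV) as (LV & HLV0 & HLV).
  assert (Hchi : forall v, 0 <= chi v <= 1) by (intros; apply clamp_bounds; lra).
  destruct (picard_lindelof F x (Lf + Bf * LV) Bf) as (z & Hz0 & Hz).
  - pose proof (Rmult_le_pos Bf LV). lra.
  - exact HBf0.
  - intros y w i. unfold F. set (N := sumFin n (fun k => Rabs (y k - w k))).
    assert (H1 := HLf i y w). fold N in H1. 
    assert (H2 : Rabs (chi (V (c y)) - chi (V (c w))) <= LV * N).
    { eapply Rle_trans; [apply clamp_lipschitz|].
      replace (V x + 1 - V (c y) - (V x + 1 - V (c w))) with (- (V (c y) - V (c w))) by ring.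
      rewrite Rabs_Ropp. eapply Rle_trans; [apply HLV; apply Hcbox|].
      apply Rmult_le_compat_l; [lra|apply Hclip]. }
    replace (chi (V (c y)) * f (c y) i - chi (V (c w)) * f (c w) i)
      with (chi (V (c y)) * (f (c y) i - f (c w) i)
            + (chi (V (c y)) - chi (V (c w))) * f (c w) i) by ring.
    eapply Rle_trans; [apply Rabs_triang|]. rewrite !Rabs_mult.
    specialize (HBf i w). specialize (Hchi (V (c y))).
    rewrite (Rabs_right (chi (V (c y)))) by lra.
    pose proof (Rabs_pos (f (c w) i)). pose proof (Rabs_pos (f (c y) i - f (c w) i)).
    pose proof (Rabs_pos (chi (V (c y)) - chi (V (c w)))).
    assert (Rabs (chi (V (c y)) - chi (V (c w))) * Rabs (f (c w) i) <= (LV * N) * Bf)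
      by (apply Rmult_le_compat; easy).
    nra.
  - intros y i. unfold F. rewrite Rabs_mult. specialize (Hchi (V (c y))).
    rewrite Rabs_right by lra. specialize (HBf i y). pose proof (Rabs_pos (f (c y) i)). nra.
  - assert (Hdec : forall y, sumFin n (fun k => pderiv V k y * F y k) <= 0).
    { intros y. destruct (classic (exists k, Q < Rabs (y k))) as [[k Hk]|Hin].
      - assert (Hz' : chi (V (c y)) = 0).
        { assert (HVc : V x + 1 <= V (c y)).
          { apply HQ. eapply Rle_trans; [|apply (vnorm_ge_coord n (c y) k)].
            unfold c, clamp, Rmax, Rmin. revert Hk.
            repeat destruct Rle_dec; unfold Rabs; repeat destruct Rcase_abs; lra. }
          unfold chi, clamp, Rmax, Rmin. repeat destruct Rle_dec; lra. }
        unfold F. rewrite (sumFin_ext n _ (fun _ => 0)), sumFin_const by (intros; rewrite Hz'; ring).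
        lra.
      - assert (Hc : c y = y).
        { apply functional_extensionality; intros k. apply clamp_id.
          apply Rabs_le_between, Rnot_lt_le. intros Hk. apply Hin. now exists k. }
        unfold F. rewrite Hc.
        rewrite (sumFin_ext n _ (fun k => chi (V y) * (pderiv V k y * f y k))) by (intros; ring).
        rewrite sumFin_scal. specialize (HLie y). unfold Lie in HLie.
        specialize (Hchi (V y)). nra. }
    assert (HVz : forall t, 0 <= t -> V (z t) <= V x).
    { intros t Ht.
      pose proof (Dwithin_monotone t (fun s => 0 - V (z s))
        (fun s => 0 - sumFin n (fun k => pderiv V k (z s) * F (z s) k))) as H.
      specialize (H ltac:(intros s Hs; apply Dwithin_minus;
        [apply Dwithin_of_derivable, derivable_pt_lim_const
        |apply Dwithin_chain; [exact HV|intros k; apply Dwithin_of_derivable, Hz, Hs]])).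
      specialize (H ltac:(intros s Hs; specialize (Hdec (z s)); lra) t ltac:(unfold Icc; lra)).
      simpl in H. rewrite Hz0 in H. lra. }
    exists z. split; [exact Hz0|]. intros t [Ht0 HtT] k.
    apply Dwithin_of_derivable.
    replace (f (z t) k) with (F (z t) k); [now apply Hz|].
    specialize (HVz t Ht0).
    assert (Hc : c (z t) = z t).
    { apply functional_extensionality; intros j. apply clamp_id, Rabs_le_between.
      eapply Rle_trans; [apply vnorm_ge_coord|]. apply Rnot_lt_le. intros Hlt.
      specialize (HQ (z t) ltac:(lra)). lra. }
    unfold F. rewrite Hc.
    replace (chi (V (z t))) with 1; [ring|].
    unfold chi, clamp, Rmax, Rmin. repeat destruct Rle_dec; lra.
Qed.

(** * Lyapunov decrease over one step *)

Lemma nderiv_within_cont S k g i : Ck_within S k g -> (i <= k)%nat ->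
  forall t, S t -> cont_within S (nderiv_within S i g) t.
Proof.
  intros Hg Hi t Ht. destruct (nderiv_within_spec S k g Hg) as [H1 H2].
  destruct (Nat.eq_dec i k) as [->|Hne]; [now apply H2|].
  eapply Dwithin_cont, H1; [lia|easy].
Qed.

(** Along the flow, each derivative of [V] is the next Lie derivative, by the chain rule. Since [V]
    is Lipschitz on a box containing both curves, the order condition passes from the curves to [V],
    and coefficient comparison applies to the difference. *)
Lemma nderiv_within_eq_LieIter n p (f : vec n -> vec n) V x T (Phi z : R -> vec n) C :
  0 < T -> CkV p f -> Ck (S p) V -> is_sol_on f x T z ->
  Ck_within (Icc 0 T) (S p) (fun h => V (Phi h)) ->
  (forall h, Icc 0 T h -> vnorm (vsub (z h) (Phi h)) <= C * h ^ S p) ->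
  forall i, (i <= p)%nat ->
    nderiv_within (Icc 0 T) i (fun h => V (Phi h)) 0 = LieIter f i V x.
Proof.
  intros HT Hf HV [Hz0 Hz] Hg Hord i Hi.
  destruct (nderiv_within_spec _ _ _ Hg) as [Hn1 Hn2].
  assert (Hzc : forall t, Icc 0 T t -> forall k, cont_within (Icc 0 T) (fun s => z s k) t).
  { intros t Ht k. eapply Dwithin_cont, Hz, Ht. }
  destruct (fin_uniform_bound n (fun k B => forall t, Icc 0 T t -> Rabs (z t k) <= B))
    as (Bz & HBz0 & HBz).
  { intros k B B' HB H t Ht. eapply Rle_trans; [now apply H|easy]. }
  { intros k. destruct (cont_within_bounded T (fun s => z s k)) as (B & _ & HB); [lra|auto|].
    now exists B. }
  assert (Hdiff : forall h, Icc 0 T h -> forall k, Rabs (z h k - Phi h k) <= Rabs C * h ^ S p).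
  { intros h Hh k. eapply Rle_trans; [apply (vnorm_ge_coord n (vsub (z h) (Phi h)) k)|].
    eapply Rle_trans; [apply Hord, Hh|]. apply Rmult_le_compat_r; [|apply Rle_abs].
    apply pow_le, Hh. }
  (* [Bz] bounds the flow and the second term its distance to the numerical curve. *)
  destruct (Ck1_lipschitz_on_box n V (Bz + Rabs C * T ^ S p)) as (LV & HLV0 & HLV).
  { apply Ck_le with (S p); [lia|easy]. }
  assert (Hpow : forall h, Icc 0 T h -> 0 <= h ^ S p <= T ^ S p).
  { intros h Hh. split; [apply pow_le, Hh|apply pow_incr, Hh]. }
  pose proof (Rabs_pos C) as HC0.
  pose proof (taylor_coef_eq0 T p
    (fun i t => nderiv_within (Icc 0 T) i (fun h => V (Phi h)) t - LieIter f i V (z t))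
    (LV * (INR n * Rabs C)) HT) as HD.
  rewrite <- Hz0. apply Rminus_diag_uniq, HD; [| | |easy].
  - intros j t Hj Ht. apply Dwithin_minus; [now apply Hn1|].
    apply (Dwithin_Lie n (Icc 0 T) f (LieIter f j V) z t).
    + apply Ck_le with (S p - j)%nat; [lia|]. apply Ck_LieIter; [lia|easy|easy].
    + now apply Hz.
  - intros t Ht. apply cont_within_minus; [now apply Hn2|].
    apply cont_within_compose; [now apply Hzc|].
    eapply Ck_cont. apply (Ck_LieIter n p f V (S p)); [lia|easy|easy].
  - intros h Hh. simpl. specialize (Hpow h Hh).
    assert (Hle : Rabs C * h ^ S p <= Rabs C * T ^ S p) by (apply Rmult_le_compat_l; lra).
    eapply Rle_trans; [apply HLV|].
    + intros k. eapply Rle_trans; [now apply HBz|].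
      assert (0 <= Rabs C * T ^ S p) by (apply Rmult_le_pos; lra). lra.
    + intros k. specialize (Hdiff h Hh k). specialize (HBz k h Hh).
      replace (Phi h k) with (z h k - (z h k - Phi h k)) by ring.
      eapply Rle_trans; [apply Rabs_triang|]. rewrite Rabs_Ropp. lra.
    + change (h * h ^ p) with (h ^ S p).
      replace (LV * (INR n * Rabs C) * h ^ S p) with (LV * (INR n * (Rabs C * h ^ S p))) by ring.
      apply Rmult_le_compat_l; [lra|]. rewrite <- sumFin_const. apply sumFin_le.
      intros k. rewrite Rabs_minus_sym. now apply Hdiff.
Qed.

(** A bound must be supplied first: for an unbounded set there is no least upper bound and [supR] is
    an arbitrary value. *)
Lemma supR_ge (P : R -> Prop) B : (forall y, P y -> y <= B) -> forall y, P y -> y <= supR P.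
Proof.
  intros HB y Hy. unfold supR.
  assert (Hlub : exists l, is_lub P l).
  { destruct (completeness P) as [l Hl]; [now exists B|now exists y|now exists l]. }
  now apply (epsilon_spec (inhabits 0) _ Hlub).
Qed.

Lemma min1_attained (K : nat -> R) p : (1 <= p)%nat ->
  exists j, (1 <= j <= p)%nat /\ min1 K p = K j.
Proof.
  destruct p as [|p]; [lia|]. intros _. induction p as [|p (j & Hj & IH)].
  - exists 1%nat. split; [lia|easy].
  - change (min1 K (S (S p))) with (Rmin (min1 K (S p)) (K (S (S p)))).
    unfold Rmin. destruct Rle_dec.
    + exists j. split; [lia|easy].
    + exists (S (S p)). split; [lia|easy].
Qed.

(** Factoring out [h ^ 2] exposes the sum that occurs in [Kconst]. *)
Lemma taylor_poly_split q (a : nat -> R) h :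
  taylor_poly (S (S q)) a h = a 0%nat + h * a 1%nat
    + h ^ 2 * sum_f 2 (S (S q)) (fun i => h ^ (i - 2) / INR (fact i) * a i).
Proof.
  unfold sum_f. replace (S (S q) - 2)%nat with q by lia.
  induction q as [|q IH].
  - unfold taylor_poly. simpl. field.
  - change (taylor_poly (S (S (S q))) a h) with
      (taylor_poly (S (S q)) a h + a (S (S (S q))) * h ^ S (S (S q)) / INR (fact (S (S (S q))))).
    rewrite IH, tech5. replace (S q + 2)%nat with (S (S (S q))) by lia.
    replace (S (S (S q)) - 2)%nat with (S q) by lia.
    change (h ^ S (S (S q))) with (h * (h * h ^ S q)).
    unfold Rdiv. ring.
Qed.

Lemma sum_f_abs_le j (c c' : nat -> R) :
  (forall i, Rabs (c i) <= c' i) -> sum_f 2 j c <= sum_f 2 j c'.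
Proof.
  intros H. apply sum_Rle. intros i _. eapply Rle_trans; [apply Rle_abs|apply H].
Qed.

(* A Taylor upper bound of order [j + 1] whose first coefficients are the Lie
   derivatives of [V]; the supremum defining [Kconst] is instantiated at [s := h]. *)
Lemma step_le_Kconst n (f : vec n -> vec n) V F (phi : vec n -> R) x p j :
  let g := fun h => V (vadd x (vscal h (F h x))) in
  let I := Icc 0 (phi x) in
  0 < phi x -> (1 <= j <= p)%nat -> Ck_within I (S p) g ->
  (forall i, (i <= p)%nat -> nderiv_within I i g 0 = LieIter f i V x) ->
  forall h, I h -> g h <= V x + h * Lie f V x + h ^ 2 * Kconst f V F phi j x.
Proof.
  intros g I HT Hj Hg HL h Hh.
  destruct (nderiv_within_spec I (S p) g Hg) as [Hn _].
  assert (Hbd : forall i, (i <= S p)%nat ->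
    exists B, 0 <= B /\ forall t, I t -> Rabs (nderiv_within I i g t) <= B).
  { intros i Hi. apply cont_within_bounded; [lra|].
    apply (nderiv_within_cont I (S p) g i Hg Hi). }
  assert (Htay : forall B, (forall t, I t -> nderiv_within I (S j) g t <= B) ->
    g h <= taylor_poly j (fun i => LieIter f i V x) h + B * h ^ S j / INR (fact (S j))).
  { intros B HB.
    pose proof (taylor_upper (phi x) (S j) (fun i => nderiv_within I i g)
      (fun i => if Nat.eqb i (S j) then B else LieIter f i V x)) as H.
    specialize (H ltac:(intros; apply Hn; [lia|easy])).
    specialize (H ltac:(intros i Hi; simpl; rewrite (proj2 (Nat.eqb_neq i (S j))) by lia;
      apply HL; lia)).
    specialize (H ltac:(intros t Ht; cbv beta; rewrite Nat.eqb_refl; now apply HB) h Hh).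
    unfold taylor_poly in *. rewrite tech5 in H. rewrite Nat.eqb_refl in H.
    erewrite sum_eq in H; [exact H|].
    intros i Hi. simpl. rewrite (proj2 (Nat.eqb_neq i (S j))) by lia. reflexivity. }
  destruct j as [|[|q]]; [lia| |].
  - destruct (Hbd 2%nat ltac:(lia)) as (B & HB0 & HB).
    (* The factor 2 undoes the one half in [Kconst] for [j = 1], leaving the supremum of the second
       derivative. *)
    specialize (Htay (2 * Kconst f V F phi 1 x)).
    specialize (Htay ltac:(intros t Ht; unfold Kconst; fold g; fold I;
      replace (2 * (/ 2 * supR (fun y => exists h, I h /\ y = nderiv_within I 2 g h)))
        with (supR (fun y => exists h, I h /\ y = nderiv_within I 2 g h)) by field;
      apply supR_ge with B; [|now exists t];
      intros y (s & Hs & ->); eapply Rle_trans; [apply Rle_abs|now apply HB])).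
    unfold taylor_poly in Htay. simpl in Htay. unfold LieIter in Htay. simpl in Htay.
    eapply Rle_trans; [exact Htay|]. simpl. right. field.
  - set (j := S (S q)) in *.
    destruct (Hbd (S j) ltac:(lia)) as (B & HB0 & HB).
    set (c s i := s ^ (i - 2) / INR (fact i) * LieIter f i V x).
    assert (Hf : forall i, 0 < / INR (fact i)) by (intros; apply Rinv_0_lt_compat, INR_fact_lt_0).
    assert (HK : forall t, I t ->
      sum_f 2 j (c h) + h ^ (j - 1) / INR (fact (j + 1)) * nderiv_within I (j + 1) g t
      <= Kconst f V F phi j x).
    { intros t Ht. unfold Kconst, j. fold j. fold g. fold I.
      apply supR_ge with (sum_f 2 j (fun i => phi x ^ (i - 2) / INR (fact i) * Rabs (LieIter f i V x))
        + phi x ^ (j - 1) / INR (fact (j + 1)) * B).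
      - intros y (t' & s & Ht' & Hs & ->). apply Rplus_le_compat.
        + apply sum_f_abs_le. intros i. unfold Rdiv. rewrite !Rabs_mult.
          apply Rmult_le_compat_r; [apply Rabs_pos|].
          rewrite (Rabs_right (/ _)) by (apply Rle_ge, Rlt_le, Hf).
          apply Rmult_le_compat_r; [apply Rlt_le, Hf|].
          rewrite Rabs_right by (apply Rle_ge, pow_le, Hs). apply pow_incr, Hs.
        + eapply Rle_trans; [apply Rle_abs|]. unfold Rdiv. rewrite !Rabs_mult.
          apply Rmult_le_compat; [|apply Rabs_pos| |].
          * apply Rmult_le_pos; apply Rabs_pos.
          * rewrite (Rabs_right (/ _)) by (apply Rle_ge, Rlt_le, Hf).
            apply Rmult_le_compat_r; [apply Rlt_le, Hf|].
            rewrite Rabs_right by (apply Rle_ge, pow_le, Hs). apply pow_incr, Hs.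
          * rewrite Nat.add_1_r. now apply HB.
      - exists t, h. easy. }
    destruct (Req_dec h 0) as [->|Hh0].
    { unfold g. rewrite vadd_scal0. simpl. lra. }
    assert (Hhpos : 0 < h) by (destruct Hh; lra).
    assert (Hp : 0 < h ^ (j - 1)) by now apply pow_lt.
    pose proof (INR_fact_lt_0 (S j)) as HF.
    (* This is [HK] solved for the derivative of order [j + 1]; the division by a power of [h] is
       why [h = 0] was treated separately. *)
    specialize (Htay ((Kconst f V F phi j x - sum_f 2 j (c h)) * INR (fact (S j)) / h ^ (j - 1))).
    eapply Rle_trans; [apply Htay|].
    + intros t Ht. specialize (HK t Ht). rewrite Nat.add_1_r in HK.
      apply Rmult_le_reg_r with (h ^ (j - 1) / INR (fact (S j))); [apply Rdiv_lt_0_compat; easy|].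
      replace ((Kconst f V F phi j x - sum_f 2 j (c h)) * INR (fact (S j)) / h ^ (j - 1)
        * (h ^ (j - 1) / INR (fact (S j)))) with (Kconst f V F phi j x - sum_f 2 j (c h))
        by (field; lra).
      lra.
    + unfold j at 1. rewrite taylor_poly_split. fold j. fold (c h).
      replace (h ^ S j) with (h ^ 2 * h ^ (j - 1)).
      2: { rewrite <- pow_add. reflexivity. }
      unfold LieIter at 1 2. simpl Nat.iter. right. field. split; lra.
Qed.

(** To replace [T] by [h] in the hypothesis: if [K >= 0] the product only shrinks, and if [K < 0] it
    is at most 0, while [(lambda - 1) * L] is nonnegative. *)
Lemma step_decrease lambda h T K L :
  0 < lambda < 1 -> 0 <= h <= T -> L <= 0 -> T * K <= (lambda - 1) * L ->
  h * L + h ^ 2 * K <= lambda * (h * L).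
Proof.
  intros Hl Hh HL HK.
  assert (H : h * K <= (lambda - 1) * L).
  { destruct (Rle_or_lt 0 K); nra. }
  assert (h * (h * K) <= h * ((lambda - 1) * L)) by (apply Rmult_le_compat_l; lra).
  nra.
Qed.

(** * The hybrid system *)

Lemma Rmax0_lipschitz a b : Rabs (Rmax 0 a - Rmax 0 b) <= Rabs (a - b).
Proof.
  unfold Rmax. repeat destruct Rle_dec; unfold Rabs; repeat destruct Rcase_abs; lra.
Qed.

Lemma continuity_pt_Rmax0 v t : continuity_pt (fun s => Rmax 0 (v - s)) t.
Proof.
  apply continuity_pt_locally. intros eps. exists eps. intros s Hs.
  eapply Rle_lt_trans; [apply Rmax0_lipschitz|].
  replace (v - s - (v - t)) with (- (s - t)) by ring. rewrite Rabs_Ropp. exact Hs.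
Qed.

Lemma vnorm_eq0 n (x : vec n) : vnorm x <= 0 -> x = vzero.
Proof.
  intros H. apply functional_extensionality; intros k. unfold vzero.
  pose proof (vnorm_ge_coord n x k). apply Rabs_eq_0. pose proof (Rabs_pos (x k)). lra.
Qed.

(** * Positive definite, radially unbounded functions *)

Section ProperFunction.
Context {n : nat} (V : vec n -> R).
Hypotheses (HVc : forall x, cont_at V x) (HV0 : V vzero = 0).
Hypothesis HVpos : forall x, x <> vzero -> 0 < V x.
Hypothesis HVrad : forall B, exists Rad, forall x, Rad <= vnorm x -> B <= V x.

Lemma sublevel_bounded B : exists Q, forall x, V x <= B -> vnorm x <= Q.
Proof.
  destruct (HVrad (B + 1)) as [Q HQ]. exists Q. intros x Hx.
  apply Rnot_lt_le. intros Hlt. specialize (HQ x ltac:(lra)). lra.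
Qed.

(** Adding [Rmax 0 (c - V x)], which is zero on the shell and positive at the origin, makes [w]
    positive everywhere, so that the bound on boxes applies. *)
Lemma positive_on_shell (w : vec n -> R) c B : 0 < c ->
  (forall x, cont_at w x) -> (forall x, x <> vzero -> 0 < w x) -> 0 <= w vzero ->
  exists m, 0 < m /\ forall x, c <= V x <= B -> m <= w x.
Proof.
  intros Hc Hwc Hw Hw0. destruct (sublevel_bounded B) as [Q HQ].
  destruct (positive_lower_bound n (fun x => w x + Rmax 0 (c - V x)) Q) as (m & Hm & H).
  - intros x. apply cont_at_plus; [apply Hwc|].
    apply (cont_at_comp n V (fun v => Rmax 0 (c - v))); [apply HVc|apply continuity_pt_Rmax0].
  - intros x. destruct (classic (x = vzero)) as [->|Hx].
    + rewrite HV0. pose proof (Rmax_r 0 (c - 0)). lra.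
    + specialize (Hw x Hx). pose proof (Rmax_l 0 (c - V x)). lra.
  - exists m. split; [easy|]. intros x Hx.
    assert (Hb : forall k, Rabs (x k) <= Q).
    { intros k. eapply Rle_trans; [apply vnorm_ge_coord|now apply HQ]. }
    specialize (H x Hb). simpl in H. rewrite Rmax_left in H by lra. lra.
Qed.

Lemma small_of_small_value eps : 0 < eps -> exists c, 0 < c /\ forall x, V x < c -> vnorm x < eps.
Proof.
  intros He. destruct (HVrad 1) as [Q HQ].
  destruct (positive_lower_bound n (fun x => V x + Rmax 0 (eps - vnorm x)) Q) as (c & Hc & H).
  - intros x. apply cont_at_plus; [apply HVc|].
    apply (cont_at_comp n vnorm (fun v => Rmax 0 (eps - v)));
      [apply cont_at_vnorm|apply continuity_pt_Rmax0].
  - intros x. destruct (classic (x = vzero)) as [->|Hx].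
    + rewrite HV0, vnorm_zero. pose proof (Rmax_r 0 (eps - 0)). lra.
    + specialize (HVpos x Hx). pose proof (Rmax_l 0 (eps - vnorm x)). lra.
  (* The level 1 keeps [x] inside the box, since [V] is at least 1 beyond radius [Q]; the level [c]
     then excludes norms of at least [eps]. *)
  - exists (Rmin c 1). split; [apply Rmin_pos; lra|]. intros x Hx.
    pose proof (Rmin_l c 1). pose proof (Rmin_r c 1).
    apply Rnot_le_lt. intros Hn.
    destruct (Rle_or_lt Q (vnorm x)) as [HQx|HQx]; [specialize (HQ x HQx); lra|].
    assert (Hb : forall k, Rabs (x k) <= Q).
    { intros k. pose proof (vnorm_ge_coord n x k). lra. }
    specialize (H x Hb). simpl in H. rewrite Rmax_left in H by lra. lra.
Qed.

End ProperFunction.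

(** * Trajectories of the hybrid system under a one-step decrease *)

Section Hybrid.
Context {n : nat} (F : R -> vec n -> vec n) (phi : vec n -> R) (V w : vec n -> R)
  (r : R) (M : R -> R).
Hypotheses (HVc : forall x, cont_at V x) (HV0 : V vzero = 0).
Hypothesis HVpos : forall x, x <> vzero -> 0 < V x.
Hypothesis HVrad : forall B, exists Rad, forall x, Rad <= vnorm x -> B <= V x.
Hypotheses (Hphic : forall x, cont_at phi x) (Hphi : forall x, 0 < phi x <= r).
Hypothesis HM0 : forall t, 0 <= t -> 0 <= M t.
Hypothesis HM : forall s t, 0 <= s <= t -> M s <= M t.
Hypothesis HF : forall x h, 0 <= h <= phi x -> vnorm (F h x) <= vnorm x * M (vnorm x).
Hypotheses (Hwc : forall x, cont_at w x) (Hw : forall x, x <> vzero -> 0 < w x) (Hw0 : 0 <= w vzero).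
Hypothesis Hstep : forall x h, 0 <= h <= phi x -> V (vadd x (vscal h (F h x))) <= V x - h * w x.

Lemma V_ge0 x : 0 <= V x.
Proof. destruct (classic (x = vzero)) as [->|Hx]; [lra|apply Rlt_le, HVpos, Hx]. Qed.

Lemma w_ge0 x : 0 <= w x.
Proof. destruct (classic (x = vzero)) as [->|Hx]; [lra|apply Rlt_le, Hw, Hx]. Qed.

Definition hyb_time u x0 k : R := fst (hyb_pts F phi u x0 k).
Definition hyb_state u x0 k : vec n := snd (hyb_pts F phi u x0 k).
Definition hyb_step u x0 k : R := phi (hyb_state u x0 k) * exp (- u (hyb_time u x0 k)).

Lemma hyb_time_S u x0 k : hyb_time u x0 (S k) = hyb_time u x0 k + hyb_step u x0 k.
Proof. unfold hyb_step, hyb_time, hyb_state. simpl. now destruct hyb_pts. Qed.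

Lemma hyb_state_S u x0 k : hyb_state u x0 (S k) =
  vadd (hyb_state u x0 k) (vscal (hyb_step u x0 k) (F (hyb_step u x0 k) (hyb_state u x0 k))).
Proof. unfold hyb_step, hyb_time, hyb_state. simpl. now destruct hyb_pts. Qed.

Lemma hyb_iff u x0 t y : hyb F phi x0 u t y <-> exists k,
  hyb_time u x0 k <= t <= hyb_time u x0 k + hyb_step u x0 k /\
  y = vadd (hyb_state u x0 k)
        (vscal (t - hyb_time u x0 k) (F (hyb_step u x0 k) (hyb_state u x0 k))).
Proof.
  unfold hyb, hyb_step, hyb_time, hyb_state.
  split; intros [k H]; exists k; destruct hyb_pts; exact H.
Qed.

Lemma hyb_time_ge0_step u x0 k : admissible u ->
  0 <= hyb_time u x0 k /\ 0 < hyb_step u x0 k <= phi (hyb_state u x0 k).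
Proof.
  intros [Hu _].
  assert (Hs : forall k, 0 <= hyb_time u x0 k -> 0 < hyb_step u x0 k <= phi (hyb_state u x0 k)).
  { intros j Hj. unfold hyb_step. specialize (Hu _ Hj). specialize (Hphi (hyb_state u x0 j)).
    pose proof (exp_pos (- u (hyb_time u x0 j))).
    assert (exp (- u (hyb_time u x0 j)) <= 1).
    { rewrite <- exp_0. destruct Hu as [Hu|<-]; [left; apply exp_increasing; lra|].
      rewrite Ropp_0. lra. }
    nra. }
  assert (H0 : 0 <= hyb_time u x0 k).
  { induction k as [|k IH]; [unfold hyb_time; simpl; lra|].
    rewrite hyb_time_S. specialize (Hs k IH). lra. }
  auto.
Qed.

Lemma hyb_V_step u x0 k : admissible u ->
  V (hyb_state u x0 (S k)) <= V (hyb_state u x0 k) - hyb_step u x0 k * w (hyb_state u x0 k).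
Proof.
  intros Hu. rewrite hyb_state_S. apply Hstep.
  destruct (hyb_time_ge0_step u x0 k Hu). lra.
Qed.

Lemma hyb_V_le u x0 k : admissible u -> V (hyb_state u x0 k) <= V x0.
Proof.
  intros Hu. induction k as [|k IH]; [unfold hyb_state; simpl; lra|].
  pose proof (hyb_V_step u x0 k Hu). destruct (hyb_time_ge0_step u x0 k Hu).
  pose proof (w_ge0 (hyb_state u x0 k)). nra.
Qed.

Definition growth (s : R) : R := s * (1 + r * M s).

Lemma r_gt0 : 0 < r.
Proof. specialize (Hphi vzero). lra. Qed.

(** Since [M] is monotone, [growth] grows at least linearly along rays. The case [a = 1] is
    monotonicity; smaller [a] lets an exponential factor pass through [growth]. *)
Lemma growth_le a s t : 0 <= a <= 1 -> 0 <= s <= a * t -> 0 <= t -> growth s <= a * growth t.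
Proof.
  intros Ha Hs Ht. unfold growth. pose proof r_gt0.
  assert (Hst : s <= t) by nra.
  pose proof (HM0 s ltac:(lra)). pose proof (HM s t ltac:(lra)).
  assert (1 + r * M s <= 1 + r * M t) by nra.
  assert (0 <= 1 + r * M s) by nra.
  replace (a * (t * (1 + r * M t))) with ((a * t) * (1 + r * M t)) by ring.
  apply Rmult_le_compat; lra.
Qed.

Lemma hyb_bound u x0 t y : admissible u -> hyb F phi x0 u t y -> exists k,
  hyb_time u x0 k <= t <= hyb_time u x0 k + r /\ vnorm y <= growth (vnorm (hyb_state u x0 k)).
Proof.
  intros Hu H. apply hyb_iff in H. destruct H as (k & Hk & ->).
  exists k. destruct (hyb_time_ge0_step u x0 k Hu) as [Ht Hh].
  specialize (Hphi (hyb_state u x0 k)). split; [lra|].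
  eapply Rle_trans; [apply vnorm_triangle|]. rewrite vnorm_scal, Rabs_right by lra.
  unfold growth.
  pose proof (HF (hyb_state u x0 k) (hyb_step u x0 k) ltac:(lra)) as H1.
  pose proof (vnorm_ge0 n (F (hyb_step u x0 k) (hyb_state u x0 k))) as H2.
  assert ((t - hyb_time u x0 k) * vnorm (F (hyb_step u x0 k) (hyb_state u x0 k))
    <= r * (vnorm (hyb_state u x0 k) * M (vnorm (hyb_state u x0 k))))
    by (apply Rmult_le_compat; lra).
  lra.
Qed.

(** Grid times cannot accumulate: the states stay in a bounded sublevel set, where [phi] is at least
    some [c > 0], and [u <= B] up to time [t], so every step begun before [t] has length at least
    [c * exp (- B)]. *)
Lemma hyb_exists u x0 t : admissible u -> 0 <= t -> exists y, hyb F phi x0 u t y.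
Proof.
  intros Hu Ht.
  assert (Hreach : exists k, t <= hyb_time u x0 k).
  { destruct (sublevel_bounded V HVrad (V x0)) as [Q HQ].
    destruct (positive_lower_bound n phi Q Hphic) as (c & Hc & Hcphi); [apply Hphi|].
    destruct (proj2 Hu t) as [B HB].
    apply NNPP. intros Hno.
    assert (Hlt : forall k, hyb_time u x0 k < t).
    { intros k. apply Rnot_le_lt. intros H. apply Hno. now exists k. }
    assert (Hk : forall k, INR k * (c * exp (- B)) <= hyb_time u x0 k).
    { induction k as [|k IH]; [unfold hyb_time; simpl; lra|].
      rewrite hyb_time_S, S_INR.
      assert (c * exp (- B) <= hyb_step u x0 k); [|lra].
      unfold hyb_step. apply Rmult_le_compat; [lra|apply Rlt_le, exp_pos| |].
      - apply Hcphi. intros i. eapply Rle_trans; [apply vnorm_ge_coord|].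
        apply HQ. now apply hyb_V_le.
      - assert (Hub : u (hyb_time u x0 k) <= B).
        { apply HB. destruct (hyb_time_ge0_step u x0 k Hu). specialize (Hlt k). lra. }
        destruct Hub as [Hub| ->]; [left; apply exp_increasing; lra|lra]. }
    assert (Hpos : 0 < c * exp (- B)) by (apply Rmult_lt_0_compat; [easy|apply exp_pos]).
    destruct (INR_unbounded (t / (c * exp (- B)))) as [k Hkt].
    specialize (Hk k). specialize (Hlt k).
    apply (Rmult_lt_compat_r (c * exp (- B))) in Hkt; [|easy].
    unfold Rdiv in Hkt. rewrite Rmult_assoc, Rinv_l, Rmult_1_r in Hkt by lra. lra. }
  assert (Hex : exists k, hyb_time u x0 k <= t <= hyb_time u x0 k + hyb_step u x0 k).
  { destruct Hreach as [k Hk]. induction k as [|k IH].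
    - exists 0%nat. destruct (hyb_time_ge0_step u x0 0 Hu) as [_ H].
      unfold hyb_time in Hk |- * at 1 2. simpl in *. lra.
    - destruct (Rle_or_lt t (hyb_time u x0 k)) as [H|H]; [now apply IH|].
      exists k. rewrite hyb_time_S in Hk. lra. }
  destruct Hex as [k Hk]. eexists. apply hyb_iff. exists k. split; [exact Hk|reflexivity].
Qed.

Lemma growth_small eps : 0 < eps -> exists c, 0 < c /\ forall x, V x < c -> growth (vnorm x) < eps.
Proof.
  intros He. pose proof r_gt0. pose proof (HM0 1 ltac:(lra)).
  assert (Hg : 0 < growth 1) by (unfold growth; nra).
  set (e := Rmin 1 (eps / (2 * growth 1))).
  assert (He0 : 0 < e) by (apply Rmin_pos; [lra|apply Rdiv_lt_0_compat; lra]).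
  destruct (small_of_small_value V HVc HV0 HVpos HVrad e He0) as (c & Hc & H').
  exists c. split; [easy|]. intros x Hx. specialize (H' x Hx).
  pose proof (Rmin_l 1 (eps / (2 * growth 1))) as H1. pose proof (Rmin_r 1 (eps / (2 * growth 1))) as H2.
  fold e in H1, H2. pose proof (vnorm_ge0 n x).
  apply Rle_lt_trans with (e * growth 1); [apply growth_le; lra|].
  apply Rle_lt_trans with (eps / (2 * growth 1) * growth 1); [apply Rmult_le_compat_r; lra|].
  replace (eps / (2 * growth 1) * growth 1) with (eps / 2) by (field; lra). lra.
Qed.

Lemma V_bounded_on_ball Rad : exists B, 0 < B /\ forall x, vnorm x <= Rad -> V x <= B.
Proof.
  destruct (bounded_on_box n V Rad HVc) as (B & HB0 & HB). exists B. split; [easy|].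
  intros x Hx. eapply Rle_trans; [apply Rle_abs|]. apply HB. intros k.
  eapply Rle_trans; [apply vnorm_ge_coord|easy].
Qed.

Lemma hyb_urgas : URGAS (hyb F phi).
Proof.
  pose proof r_gt0 as Hr.
  split; [|split; [|split]].
  - intros x0 u Hu t Ht. now apply hyb_exists.
  - intros eps He. destruct (growth_small eps He) as (c & Hc & Hg).
    destruct (HVc vzero c Hc) as (d & Hd & H).
    exists d. split; [easy|]. intros x0 u t y Hu Hx0 Ht Hy.
    destruct (hyb_bound u x0 t y Hu Hy) as (k & _ & Hk).
    eapply Rle_lt_trans; [exact Hk|]. apply Hg.
    eapply Rle_lt_trans; [now apply hyb_V_le|].
    specialize (H x0).
    replace (vsub x0 vzero) with x0 in H
      by (apply functional_extensionality; intros; unfold vsub, vzero; ring).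
    specialize (H Hx0). apply Rabs_def2 in H. lra.
  - intros Rad. destruct (V_bounded_on_ball Rad) as (B & _ & HB).
    destruct (sublevel_bounded V HVrad B) as [Q HQ].
    exists (growth Q). intros x0 u t y Hu Hx0 Ht Hy.
    destruct (hyb_bound u x0 t y Hu Hy) as (k & _ & Hk).
    eapply Rle_trans; [exact Hk|].
    assert (H : vnorm (hyb_state u x0 k) <= Q).
    { apply HQ. eapply Rle_trans; [now apply hyb_V_le|now apply HB]. }
    pose proof (vnorm_ge0 n (hyb_state u x0 k)).
    rewrite <- (Rmult_1_l (growth Q)). apply growth_le; lra.
  - intros eps Rad He. destruct (growth_small eps He) as (c & Hc & Hg).
    destruct (V_bounded_on_ball Rad) as (B & HB0 & HB).
    destruct (positive_on_shell V HVc HV0 HVrad w c B Hc Hwc Hw Hw0) as (m & Hm & Hwm).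
    (* After time [B / m] a decrease at rate [m] would make [V] negative; [r] covers the lag between
       [t] and its grid point, and 1 makes the inequality strict. *)
    exists (B / m + r + 1). intros x0 u t y Hu Hx0 Ht Hy.
    destruct (hyb_bound u x0 t y Hu Hy) as (k & Htk & Hk).
    eapply Rle_trans; [exact Hk|]. apply Rlt_le, Hg.
    assert (Hinv : forall j, V (hyb_state u x0 j) < c \/
              V (hyb_state u x0 j) <= B - m * hyb_time u x0 j).
    { induction j as [|j IH].
      - right. unfold hyb_time, hyb_state. simpl. specialize (HB x0 Hx0). lra.
      - pose proof (hyb_V_step u x0 j Hu) as HVs.
        destruct (hyb_time_ge0_step u x0 j Hu) as [_ Hh].
        pose proof (w_ge0 (hyb_state u x0 j)) as Hwj.
        destruct (Rlt_or_le (V (hyb_state u x0 j)) c) as [Hlt|Hle]; [left; nra|].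
        right. destruct IH as [IH|IH]; [lra|].
        assert (m <= w (hyb_state u x0 j)).
        { apply Hwm. split; [easy|]. eapply Rle_trans; [now apply hyb_V_le|now apply HB]. }
        rewrite hyb_time_S. nra. }
    destruct (Hinv k) as [H|H]; [easy|]. exfalso.
    assert (B < m * hyb_time u x0 k).
    { assert (Hlt : B / m < hyb_time u x0 k) by lra.
      apply (Rmult_lt_compat_l m) in Hlt; [|easy].
      replace (m * (B / m)) with B in Hlt by (field; lra). easy. }
    pose proof (V_ge0 (hyb_state u x0 k)). lra.
Qed.

(** One step multiplies [V] by at most [1 - rho * h <= exp (- rho * h)], and the exponents add up to
    the grid time. *)
Lemma hyb_V_exp u x0 k rho : admissible u -> (forall x, rho * V x <= w x) ->
  V (hyb_state u x0 k) <= exp (- rho * hyb_time u x0 k) * V x0.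
Proof.
  intros Hu Hrho. induction k as [|k IH].
  - unfold hyb_time, hyb_state. simpl. rewrite Rmult_0_r, exp_0. lra.
  - pose proof (hyb_V_step u x0 k Hu) as Hs. destruct (hyb_time_ge0_step u x0 k Hu) as [_ Hh].
    rewrite hyb_time_S, Rmult_plus_distr_l, exp_plus.
    specialize (Hrho (hyb_state u x0 k)). pose proof (V_ge0 (hyb_state u x0 k)) as HV.
    apply Rle_trans with (exp (- rho * hyb_step u x0 k) * V (hyb_state u x0 k)).
    + pose proof (exp_ineq1_le (- rho * hyb_step u x0 k)) as He.
      apply Rle_trans with ((1 + - rho * hyb_step u x0 k) * V (hyb_state u x0 k));
        [nra|apply Rmult_le_compat_r; easy].
    + pose proof (exp_pos (- rho * hyb_step u x0 k)).
      replace (exp (- rho * hyb_time u x0 k) * exp (- rho * hyb_step u x0 k) * V x0)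
        with (exp (- rho * hyb_step u x0 k) * (exp (- rho * hyb_time u x0 k) * V x0)) by ring.
      apply Rmult_le_compat_l; lra.
Qed.

(** The quadratic lower bound turns decay of [V] at rate [2 * sigma] into decay of the state at rate
    [sigma]. The factor [exp (sigma * r)] pays for measuring time at [t] instead of at the preceding
    grid point. *)
Lemma hyb_exp_bound (alpha : R -> R) sigma K : 0 < sigma -> 0 < K ->
  (forall x, 2 * sigma * V x <= w x) -> (forall x, K * vnorm x ^ 2 <= V x) ->
  (forall x, V x <= alpha (vnorm x)) ->
  forall x0 u t y, admissible u -> hyb F phi x0 u t y ->
    vnorm y <= exp (- sigma * t) * (exp (sigma * r) * growth (sqrt (alpha (vnorm x0) / K))).
Proof.
  intros Hsig HK HwV HVK Halpha x0 u t y Hu Hy.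
  destruct (hyb_bound u x0 t y Hu Hy) as (k & Htk & Hk).
  destruct (hyb_time_ge0_step u x0 k Hu) as [Ht0 _].
  set (e := exp (- sigma * hyb_time u x0 k)).
  assert (He : 0 < e <= 1).
  { split; [apply exp_pos|]. unfold e. rewrite <- exp_0.
    destruct (Rle_lt_or_eq_dec 0 (hyb_time u x0 k) Ht0) as [H|<-].
    - left. apply exp_increasing. nra.
    - rewrite Rmult_0_r. lra. }
  set (a := alpha (vnorm x0) / K).
  assert (Ha : V x0 / K <= a).
  { apply Rmult_le_compat_r; [apply Rlt_le, Rinv_0_lt_compat, HK|apply Halpha]. }
  assert (Ha0 : 0 <= a).
  { eapply Rle_trans; [|exact Ha]. apply Rdiv_le_0_compat; [apply V_ge0|easy]. }
  assert (Hs : vnorm (hyb_state u x0 k) <= e * sqrt a).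
  { apply Rsqr_incr_0_var; [|apply Rmult_le_pos; [lra|apply sqrt_pos]].
    rewrite Rsqr_mult, Rsqr_sqrt, Rsqr_pow2 by easy.
    pose proof (hyb_V_exp u x0 k (2 * sigma) Hu HwV) as HV.
    replace (exp (- (2 * sigma) * hyb_time u x0 k)) with (Rsqr e) in HV.
    2: { unfold Rsqr, e. rewrite <- exp_plus. f_equal. ring. }
    specialize (HVK (hyb_state u x0 k)).
    apply Rmult_le_reg_l with K; [easy|]. eapply Rle_trans; [exact HVK|].
    eapply Rle_trans; [exact HV|].
    replace (K * (Rsqr e * a)) with (Rsqr e * (K * a)) by ring.
    apply Rmult_le_compat_l; [apply Rle_0_sqr|].
    apply (Rmult_le_compat_l K) in Ha; [|lra].
    replace (K * (V x0 / K)) with (V x0) in Ha by (field; lra). exact Ha. }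
  eapply Rle_trans; [exact Hk|].
  apply Rle_trans with (e * growth (sqrt a)).
  - apply growth_le; [lra| |apply sqrt_pos]. split; [apply vnorm_ge0|easy].
  - rewrite <- Rmult_assoc, <- exp_plus. apply Rmult_le_compat_r.
    + unfold growth. pose proof (sqrt_pos a). pose proof (HM0 _ H). pose proof r_gt0.
      apply Rmult_le_pos; nra.
    + unfold e. assert (Hle : - sigma * hyb_time u x0 k <= - sigma * t + sigma * r) by nra.
      destruct Hle as [Hle|Hle]; [left; now apply exp_increasing|rewrite Hle; lra].
Qed.

End Hybrid.

(* [sup {V x : |x| <= s}] is locally Lipschitz in [s] because shrinking a point of the
   larger ball moves it by at most the difference of the radii. *)
Lemma ball_sup_majorant n (V : vec n -> R) : Ck 1 V -> V vzero = 0 -> (forall x, 0 <= V x) ->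
  exists m : R -> R, m 0 = 0 /\ (forall x, V x <= m (vnorm x)) /\
    (forall s t, 0 <= s <= t -> m s <= m t) /\
    (forall t, 0 <= t -> cont_within (fun s => 0 <= s) m t).
Proof.
  intros HV HV0 HVpos.
  assert (Hlub : forall s, exists l, 0 <= s -> is_lub (fun y => exists x, vnorm x <= s /\ y = V x) l).
  { intros s. destruct (Rle_dec 0 s) as [Hs|Hs]; [|exists 0; easy].
    destruct (bounded_on_box n V s (Ck1_cont n V HV)) as (B & _ & HB).
    destruct (completeness (fun y => exists x : vec n, vnorm x <= s /\ y = V x)) as [l Hl].
    - exists B. intros y (x & Hx & ->). eapply Rle_trans; [apply Rle_abs|]. apply HB.
      intros k. eapply Rle_trans; [apply vnorm_ge_coord|easy].
    - exists (V vzero), vzero. rewrite vnorm_zero. easy.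
    - now exists l. }
  destruct (functional_choice _ Hlub) as [m Hm].
  assert (Hub : forall s x, vnorm x <= s -> V x <= m s).
  { intros s x Hx. apply (Hm s); [pose proof (vnorm_ge0 n x); lra|]. now exists x. }
  assert (Hmono : forall s t, 0 <= s <= t -> m s <= m t).
  { intros s t Hst. apply (Hm s); [lra|]. intros y (x & Hx & ->). apply Hub. lra. }
  assert (Hlip : forall Q, exists C, 0 < C /\ forall s t, 0 <= s <= t -> t <= Q ->
            m t <= m s + C * (t - s)).
  { intros Q. destruct (Ck1_lipschitz_on_box n V Q HV) as (C & HC & H).
    pose proof (pos_INR n).
    exists (C * (INR n + 1)). split; [nra|].
    intros s t Hst HtQ. apply (Hm t); [lra|]. intros y (x & Hx & ->).
    destruct (Rle_or_lt (vnorm x) s) as [Hxs|Hxs].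
    { specialize (Hub s x Hxs).
      assert (0 <= C * (INR n + 1) * (t - s)) by (apply Rmult_le_pos; nra). lra. }
    assert (Hx0 : 0 < vnorm x) by lra.
    set (c := s / vnorm x).
    assert (Hc : 0 <= c < 1).
    { split; [apply Rdiv_le_0_compat; lra|]. apply Rmult_lt_reg_r with (vnorm x); [easy|].
      unfold c. field_simplify; lra. }
    assert (Hcx : vnorm (vscal c x) = s).
    { rewrite vnorm_scal, Rabs_right by lra. unfold c. field. lra. }
    pose proof (Hub s (vscal c x) ltac:(lra)) as H1.
    specialize (H (vscal c x) x).
    specialize (H ltac:(intros k; eapply Rle_trans; [apply vnorm_ge_coord|lra])).
    specialize (H ltac:(intros k; eapply Rle_trans; [apply vnorm_ge_coord|lra])).
    assert (Hsum : sumFin n (fun k => Rabs (x k - vscal c x k)) <= INR n * (t - s)).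
    { rewrite <- sumFin_const. apply sumFin_le. intros k. unfold vscal.
      replace (x k - c * x k) with ((1 - c) * x k) by ring.
      rewrite Rabs_mult, Rabs_right by lra.
      apply Rle_trans with ((1 - c) * vnorm x).
      - apply Rmult_le_compat_l; [lra|apply vnorm_ge_coord].
      - replace ((1 - c) * vnorm x) with (vnorm x - s) by (unfold c; field; lra). lra. }
    apply (Rmult_le_compat_l C) in Hsum; [|lra].
    apply Rabs_le_between in H. nra. }
  exists m. split; [|split; [|split]].
  - apply Rle_antisym.
    + apply (Hm 0); [lra|]. intros y (x & Hx & ->). rewrite (vnorm_eq0 n x Hx). lra.
    + rewrite <- HV0. apply Hub. rewrite vnorm_zero. lra.
  - intros x. apply Hub. lra.
  - exact Hmono.
  - intros t Ht eps He. destruct (Hlip (t + 1)) as (C & HC & H).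
    assert (Hd : 0 < eps / C) by (apply Rdiv_lt_0_compat; easy).
    exists (Rmin 1 (eps / C)). split; [apply Rmin_pos; lra|].
    intros s Hs Hst. pose proof (Rmin_l 1 (eps / C)). pose proof (Rmin_r 1 (eps / C)).
    assert (HCst : C * Rabs (s - t) < eps).
    { apply Rlt_le_trans with (C * (eps / C)); [apply Rmult_lt_compat_l; lra|].
      right. field. lra. }
    assert (Hs1 : s - t < 1) by (pose proof (Rle_abs (s - t)); lra).
    destruct (Rle_or_lt s t) as [Hle|Hlt].
    + specialize (H s t ltac:(lra) ltac:(lra)). specialize (Hmono s t ltac:(lra)).
      rewrite Rabs_left1 in HCst by lra. apply Rabs_def1; lra.
    + specialize (H t s ltac:(lra) ltac:(lra)). specialize (Hmono t s ltac:(lra)).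
      rewrite Rabs_right in HCst by lra. apply Rabs_def1; lra.
Qed.

(** The majorant [m] is only nondecreasing; the added identity supplies strict monotonicity and
    unboundedness. *)
Lemma K_infinity_growth r (M m : R -> R) E K : 0 < r -> 0 < K -> 1 <= E ->
  (forall t, 0 <= t -> 0 <= M t) -> (forall s t, 0 <= s <= t -> M s <= M t) ->
  (forall t, 0 <= t -> cont_within (fun s => 0 <= s) M t) ->
  m 0 = 0 -> (forall s t, 0 <= s <= t -> m s <= m t) ->
  (forall t, 0 <= t -> cont_within (fun s => 0 <= s) m t) ->
  K_infinity (fun s => E * growth r M (sqrt ((m s + s) / K))).
Proof.
  intros Hr HK HE HM0 HM HMc Hm0 Hm Hmc.
  set (q s := sqrt ((m s + s) / K)).
  assert (Hq0 : forall s, 0 <= q s) by (intros; apply sqrt_pos).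
  assert (Hms : forall s, 0 <= s -> 0 <= m s) by (intros s Hs; rewrite <- Hm0; apply Hm; lra).
  assert (Hdiv : forall s, 0 <= s -> 0 <= (m s + s) / K).
  { intros s Hs. specialize (Hms s Hs). apply Rdiv_le_0_compat; lra. }
  assert (Hq : forall s t, 0 <= s < t -> q s < q t).
  { intros s t Hst. apply sqrt_lt_1; [apply Hdiv; lra|apply Hdiv; lra|].
    apply Rmult_lt_compat_r; [now apply Rinv_0_lt_compat|].
    specialize (Hm s t ltac:(lra)). lra. }
  assert (Hlow : forall s, q s <= E * growth r M (q s)).
  { intros s. unfold growth. specialize (Hq0 s). specialize (HM0 _ Hq0).
    assert (q s <= q s * (1 + r * M (q s))) by (assert (0 <= r * M (q s)) by nra; nra).
    assert (0 <= q s * (1 + r * M (q s))) by lra. nra. }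
  split; [|split; [|split]].
  - rewrite Hm0, Rplus_0_r. unfold Rdiv. rewrite Rmult_0_l, sqrt_0. unfold growth. ring.
  - intros t Ht.
    assert (Hqc : cont_within (fun s => 0 <= s) q t).
    { apply (cont_within_comp _ (fun s => 0 <= s) (fun s => (m s + s) / K) sqrt).
      - intros s Hs. now apply Hdiv.
      - unfold Rdiv. apply cont_within_mult;
          [|apply cont_within_of_continuity, continuity_pt_const; intros ? ?; easy].
        apply cont_within_plus; [now apply Hmc|].
        apply cont_within_of_continuity, derivable_continuous_pt, derivable_pt_id.
      - apply cont_within_of_continuity, continuity_pt_sqrt. now apply Hdiv. }
    unfold growth. fold q.
    assert (Hconst : forall c, cont_within (fun s => 0 <= s) (fun _ => c) t).
    { intros c. apply cont_within_of_continuity, continuity_pt_const. intros ? ?; easy. }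
    apply (cont_within_mult _ (fun _ => E) (fun s => q s * (1 + r * M (q s)))); [apply Hconst|].
    apply (cont_within_mult _ q (fun s => 1 + r * M (q s))); [exact Hqc|].
    apply (cont_within_plus _ (fun _ => 1) (fun s => r * M (q s))); [apply Hconst|].
    apply (cont_within_mult _ (fun _ => r) (fun s => M (q s))); [apply Hconst|].
    apply (cont_within_comp _ (fun s => 0 <= s) q M); [intros; apply Hq0|exact Hqc|].
    apply HMc, Hq0.
  - intros s t Hst. apply Rmult_lt_compat_l; [lra|]. fold (q s) (q t).
    specialize (Hq s t Hst). pose proof (Hq0 s) as Hqs. unfold growth.
    pose proof (HM0 _ Hqs). pose proof (HM (q s) (q t) ltac:(lra)).
    assert (1 + r * M (q s) <= 1 + r * M (q t)) by nra.
    assert (1 <= 1 + r * M (q s)) by nra. nra.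
  (* At this argument the identity term alone puts [B ^ 2] under the square root. *)
  - intros B. exists (K * B ^ 2). pose proof (pow2_ge_0 B).
    assert (Ht : 0 <= K * B ^ 2) by nra. split; [easy|].
    eapply Rle_trans; [|apply Hlow].
    apply Rle_trans with (sqrt (B ^ 2)).
    + rewrite <- Rsqr_pow2, sqrt_Rsqr_abs. apply Rle_abs.
    + apply sqrt_le_1; [easy|now apply Hdiv|].
      apply Rmult_le_reg_r with K; [easy|].
      replace ((m (K * B ^ 2) + K * B ^ 2) / K * K) with (m (K * B ^ 2) + K * B ^ 2) by (field; lra).
      specialize (Hms _ Ht). lra.
Qed.

Theorem theorem4p5
  (n p : nat) (f : vec n -> vec n) (V : vec n -> R)
  (s : nat) (A : Fin.t s -> Fin.t s -> R) (b : Fin.t s -> R)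
  (phi : vec n -> R) (r : R) (M : R -> R) (lambda : R)
  (* p >= 1, f in C^p, f(0)=0 *)
  (Hp : (1 <= p)%nat) (Hf : CkV p f) (Hf0 : f vzero = vzero)
  (* V in C^{p+1}(R^n; R^+), Lyapunov function *)
  (HV : Ck (S p) V) (HVpos : forall x, 0 <= V x) (HVlyap : lyapunov f V)
  (* consistent RK scheme *)
  (Hb : sumFin s b = 1)
  (* continuous step bound phi : R^n -> (0, r] *)
  (Hr : 0 < r) (Hphi_cont : forall x, cont_at phi x)
  (Hphi : forall x, 0 < phi x <= r)
  (Huniq : forall x h, 0 <= h <= phi x -> exists! Y, RK_stages A f h x Y)
  (HMcont : forall t, 0 <= t -> cont_within (fun s => 0 <= s) M t)
  (HMmono : forall t1 t2, 0 <= t1 <= t2 -> M t1 <= M t2)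
  (HFM : forall x h, 0 <= h <= phi x ->
           vnorm (RK_F A b f h x) <= vnorm x * M (vnorm x))
  (* (i) *)
  (Hi : forall x, Ck_within (Icc 0 (phi x)) (S p)
                    (fun h => V (vadd x (vscal h (RK_F A b f h x)))))
  (* (ii) order p *)
  (Hii : forall x, exists K, 0 < K /\
           forall z, is_sol_on f x (phi x) z ->
           forall h, 0 <= h <= phi x ->
             vnorm (vsub (vsub (z h) x) (vscal h (RK_F A b f h x))) <= K * h ^ (S p))
  (* (iii) *)
  (Hlam : 0 < lambda < 1)
  (Hiii : forall x, phi x * min1 (fun j => Kconst f V (RK_F A b f) phi j x) p
                    <= (lambda - 1) * Lie f V x) :
  URGAS (hyb (RK_F A b f) phi) /\
  ((exists sigma K, 0 < sigma /\ 0 < K /\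
      (forall x, Lie f V x <= - 2 * sigma * V x) /\
      (forall x, K * vnorm x ^ 2 <= V x)) ->
   robust_K_exp_stable (hyb (RK_F A b f) phi)).
Proof.
  destruct HVlyap as (HV0 & HVpd & HVrad & HV1 & HVdec).
  assert (HLie0 : Lie f V vzero = 0).
  { unfold Lie. rewrite Hf0. rewrite (sumFin_ext n _ (fun _ => 0)), sumFin_const.
    - ring.
    - intros; unfold vzero; ring. }
  assert (HLie : forall x, Lie f V x <= 0).
  { intros x. destruct (classic (x = vzero)) as [->|Hx]; [lra|apply Rlt_le, HVdec, Hx]. }
  set (F := RK_F A b f) in *.
  set (w x := lambda * (- Lie f V x)).
  assert (Hstep : forall x h, 0 <= h <= phi x -> V (vadd x (vscal h (F h x))) <= V x - h * w x).
  { intros x h Hh. specialize (Hphi x).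
    destruct (lyapunov_ode_solution n f V x (phi x)) as [z Hz]; auto.
    { intros i. apply Ck_le with p; [easy|apply Hf]. }
    destruct (Hii x) as (C & _ & HC). specialize (HC z Hz).
    assert (Hnd : forall i, (i <= p)%nat ->
      nderiv_within (Icc 0 (phi x)) i (fun h => V (vadd x (vscal h (F h x)))) 0 = LieIter f i V x).
    { apply (nderiv_within_eq_LieIter n p f V x (phi x) (fun h => vadd x (vscal h (F h x))) z C);
        auto; [lra|].
      intros u Hu. specialize (HC u Hu). eapply Rle_trans; [|exact HC]. right. f_equal.
      apply functional_extensionality; intros k. unfold vsub, vadd, vscal. ring. }
    destruct (min1_attained (fun j => Kconst f V F phi j x) p Hp) as (j & Hj & Hmin).
    specialize (Hiii x). rewrite Hmin in Hiii.
    pose proof (step_le_Kconst n f V F phi x p j ltac:(lra) Hj (Hi x) Hnd h Hh) as H1.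
    pose proof (step_decrease lambda h (phi x) _ _ Hlam Hh (HLie x) Hiii) as H2.
    cbv beta zeta in H1. unfold w. lra. }
  (* The nonnegative part keeps monotonicity, continuity and the bound on [F], and supplies the sign
     that [growth] relies on. *)
  set (M' t := Rmax 0 (M t)).
  assert (HM0 : forall t, 0 <= t -> 0 <= M' t) by (intros; apply Rmax_l).
  assert (HM : forall t1 t2, 0 <= t1 <= t2 -> M' t1 <= M' t2).
  { intros t1 t2 Ht. apply Rle_max_compat_l. now apply HMmono. }
  assert (HF : forall x h, 0 <= h <= phi x -> vnorm (F h x) <= vnorm x * M' (vnorm x)).
  { intros x h Hh. eapply Rle_trans; [now apply HFM|].
    apply Rmult_le_compat_l; [apply vnorm_ge0|apply Rmax_r]. }
  assert (HVc : forall x, cont_at V x) by (apply (Ck_cont n (S p)), HV).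
  assert (Hwc : forall x, cont_at w x).
  { intros x. apply cont_at_scal, (cont_at_comp n (Lie f V) Ropp).
    - apply (Ck_cont n p). now apply Ck_Lie.
    - apply derivable_continuous_pt. reg. }
  assert (Hw : forall x, x <> vzero -> 0 < w x).
  { intros x Hx. specialize (HVdec x Hx). unfold w. nra. }
  assert (Hw0 : 0 <= w vzero) by (unfold w; rewrite HLie0; lra).
  split.
  - apply (hyb_urgas F phi V w r M'); assumption.
  - intros (sigma & K & Hsig & HK & HLs & HVK).
    destruct (ball_sup_majorant n V HV1 HV0 HVpos) as (m & Hm0 & HVm & Hm & Hmc).
    assert (HsL : 0 < lambda * sigma) by (apply Rmult_lt_0_compat; lra).
    (* Only the fraction [lambda] of the decrease along the flow is guaranteed per step, so the rate
       [2 * sigma] for [V] becomes [2 * (lambda * sigma)]. *)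
    exists (fun s => exp (lambda * sigma * r) * growth r M' (sqrt ((m s + s) / K))), (lambda * sigma).
    split; [|split; [easy|]].
    + apply K_infinity_growth; auto.
      * pose proof (exp_ineq1_le (lambda * sigma * r)). nra.
      * intros t Ht eps He. destruct (HMcont t Ht eps He) as (d & Hd & H).
        exists d. split; [easy|]. intros y Hy Hyt.
        eapply Rle_lt_trans; [apply Rmax0_lipschitz|now apply H].
    + intros x0 u t y Hu Ht Hy.
      apply (hyb_exp_bound F phi V w r M') with (alpha := fun s => m s + s) (u := u) (t := t); auto.
      * intros x. specialize (HLs x). unfold w. nra.
      * intros x. specialize (HVm x). pose proof (vnorm_ge0 n x). lra.
Qed.
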